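(* Let $G$ be an agrarian group with finitely generated abelianisation. The Newton polytope of every element of the Whitehead group $\mathrm{Wh}(G)$ is a singleton.
   Context: $G$ is agrarian if $\mathbb{Z}G$ embeds into a skew-field. $H$ denotes the free part of the abelianisation of $G$ (finitely generated free-abelian), $K=\ker(G\to H)$. The skew-field $\mathcal{D}$: fix an embedding of $\mathbb{Z}G$ into a skew-field $\mathbb{K}$. Then $G$ acts on $\mathbb{K}$ by conjugation, preserving $\mathbb{Z}K$. Choose a set-theoretic section $s\colon H\to G$ and form the twisted group ring $\mathbb{K}H$: finite formal sums $\sum_{h}x_hh$, $x_h\in\mathbb{K}$, with multiplication $rh\cdot r'h'=r\,(s(h)r's(h)^{-1})\,\mu(h,h')\,hh'$, where $\mu(h,h')=s(h)s(h')s(hh')^{-1}\in K\subset\mathbb{K}^\times$. The map $g\mapsto (g\,s(\bar g)^{-1})\,\bar g$ (with $\bar g$ the image of $g$ in $H$) identifies $\mathbb{Z}G\cong(\mathbb{Z}K)H\subseteq\mathbb{K}H$. The ring $\mathbb{K}H$ is an Ore domain; $\mathcal{D}$ is its Ore localisation, a skew-field whose elements are $pq^{-1}$ with $p,q\in\mathbb{K}H$, $q\neq0$. Polytopes: a polytope in $H_1(H;\mathbb{R})=H\otimes\mathbb{R}$ is a compact intersection of finitely many affine halfspaces; it is integral if its vertices lie in $H$. $\mathcal{P}(H)$ is the Grothendieck group of the monoid of non-empty integral polytopes under Minkowski sum; $\mathcal{P}_T(H)$ is its quotient by the subgroup of formal differences of singletons. An element is a singleton if it is represented by a one-point polytope,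 i.e. it is $0$ in $\mathcal{P}_T(H)$. Newton polytopes: for $0\ne p\in\mathbb{K}H$, $P(p)$ is the convex hull of the support of $p$ in $H_1(H;\mathbb{R})$; $P(pq^{-1})=P(p)-P(q)$ gives a homomorphism $\mathcal{D}^\times/[\mathcal{D}^\times,\mathcal{D}^\times]\to\mathcal{P}(H)$. Whitehead group: $\mathrm{Wh}(G)$ is the quotient of $K_1(\mathbb{Z}G)=\mathrm{GL}(\mathbb{Z}G)^{ab}$ by the subgroup generated by the $1\times1$ matrices $(\pm g)$, $g\in G$. The assignment $A\mapsto P(\det(A\otimes\mathcal{D}))$ ($\det$ the Dieudonné determinant, $A\otimes \mathcal{D}$ being $A$ viewed over $\mathcal{D}$) induces a well-defined map $\mathrm{Wh}(G)\to\mathcal{P}_T(H)$; the image of an element is its Newton polytope. *)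

(* Defs.v *)
From HB Require Import structures.
From mathcomp Require Import all_boot all_order all_algebra finmap ssrAC lra.
From mathcomp.multinomials Require Import monalg.
From mathcomp Require Import all_classical all_reals topology normedtype.
Import Order.TTheory GRing.Theory Num.Theory.
Import numFieldNormedType.Exports.
Set Implicit Arguments.
Unset Strict Implicit.
Unset Printing Implicit Defensive.
Local Open Scope classical_set_scope.
Local Open Scope quotient_scope.
Local Open Scope ring_scope.

Inductive generated (G : groupType) (S : set G) : set G :=
| generated1 : generated S 1%g
| generated_in x : S x -> generated S x
| generatedM x y : generated S x -> generated S y -> generated S (x * y)%g
| generatedV x : generated S x -> generated S (x^-1)%g.

Definition finitely_generated (G : groupType) : Prop :=
  exists s : seq G, generated [set` s] = [set: G].

Record normal_subgroup (G : groupType) := NormalSubgroup {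
  nsub_set :> G -> Prop;
  nsub1 : nsub_set 1%g;
  nsubM : forall x y, nsub_set x -> nsub_set y -> nsub_set (x * y)%g;
  nsubV : forall x, nsub_set x -> nsub_set (x^-1)%g;
  nsubJ : forall x y, nsub_set x -> nsub_set (x ^ y)%g }.

Section QuotientGroup.
Variables (G : groupType) (N : normal_subgroup G).

Definition coset_rel : rel G := fun x y => `[< N (x^-1 * y)%g >].

Lemma coset_rel_is_equiv : equiv_class_of coset_rel.
Proof.
split=> [x|x y|y x z].
- by apply/asboolP; rewrite mulVg; exact: nsub1.
- by apply/asboolP/asboolP => /nsubV; rewrite invgM invgK.
- move=> /asboolP xy /asboolP yz; apply/asboolP.
  by have := nsubM xy yz; rewrite mulgA mulgK.
Qed.
Canonical coset_rel_equiv := EquivRelPack coset_rel_is_equiv.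
Canonical coset_rel_encModRel := defaultEncModRel coset_rel.

Definition quotient_group := {eq_quot coset_rel}.
HB.instance Definition _ := Choice.on quotient_group.
HB.instance Definition _ := EqQuotient.on quotient_group.

Definition quotient_proj (x : G) : quotient_group := \pi x.

Lemma quotient_projP x y : quotient_proj x = quotient_proj y <-> N (x^-1 * y)%g.
Proof. by split=> [/eqmodP/asboolP//|h]; apply/eqmodP/asboolP. Qed.

Let qmul (a b : quotient_group) := quotient_proj (repr a * repr b)%g.
Let qinv (a : quotient_group) := quotient_proj (repr a)^-1%g.

Let qreprE x : exists2 k, N k & repr (quotient_proj x) = (x * k)%g.
Proof.
have /quotient_projP h : quotient_proj x = quotient_proj (repr (quotient_proj x)).
  by rewrite /quotient_proj reprK.
by exists (x^-1 * repr (quotient_proj x))%g; rewrite // mulVKg.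
Qed.

Let qmulE x y : qmul (quotient_proj x) (quotient_proj y) = quotient_proj (x * y)%g.
Proof.
apply/esym/quotient_projP; have [k Nk ->] := qreprE x; have [l Nl ->] := qreprE y.
have -> : ((x * y)^-1 * (x * k * (y * l)) = k ^ y * l)%g.
  by rewrite invgM conjgE -!mulgA mulKg.
exact/nsubM/Nl/nsubJ.
Qed.

Let qinvE x : qinv (quotient_proj x) = quotient_proj x^-1%g.
Proof.
apply/quotient_projP; have [k Nk ->] := qreprE x.
have -> : (((x * k)^-1)^-1 * x^-1 = k ^ x^-1)%g by rewrite conjgE !invgK mulgA.
exact: nsubJ.
Qed.

Let qprojW (P : quotient_group -> Prop) :
  (forall x, P (quotient_proj x)) -> forall a, P a.
Proof. by move=> h a; rewrite -[a]reprK; exact: h. Qed.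

Let qmulA : associative qmul.
Proof.
by elim/qprojW => x; elim/qprojW => y; elim/qprojW => z; rewrite !qmulE mulgA.
Qed.
Let qmul1 : left_id (quotient_proj 1%g) qmul.
Proof. by elim/qprojW => x; rewrite qmulE mul1g. Qed.
Let qmul1r : right_id (quotient_proj 1%g) qmul.
Proof. by elim/qprojW => x; rewrite qmulE mulg1. Qed.
Let qmulV : left_inverse (quotient_proj 1%g) qinv qmul.
Proof. by elim/qprojW => x; rewrite qinvE qmulE mulVg. Qed.
Let qmulVr : right_inverse (quotient_proj 1%g) qinv qmul.
Proof. by elim/qprojW => x; rewrite qinvE qmulE mulgV. Qed.

HB.instance Definition _ := isGroup.Build quotient_group
  qmulA qmul1 qmul1r qmulV qmulVr.

Let quotient_projF : {morph quotient_proj : x y / (x / y)%g}.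
Proof. by move=> x y; rewrite -qmulE -qinvE. Qed.
HB.instance Definition _ := isGroupMorphism.Build G quotient_group quotient_proj
  quotient_projF.

Lemma quotient_groupW (P : quotient_group -> Prop) :
  (forall x, P (quotient_proj x)) -> forall a, P a.
Proof. exact: qprojW. Qed.

End QuotientGroup.

Section Abelianization.
Variable G : groupType.

Let commutators : set G := [set c | exists x y, c = [~ x, y]%g].

Let generated_commutatorsJ x y :
  generated commutators x -> generated commutators (x ^ y)%g.
Proof.
elim=> [|_ [a [b ->]]|a b _ ha _ hb|a _ ha].
- by rewrite conj1g; exact: generated1.
- by rewrite conjRg; apply: generated_in; exists (a ^ y)%g, (b ^ y)%g.
- by rewrite conjMg; exact: generatedM.
- by rewrite conjVg; exact: generatedV.
Qed.

Definition commutator_subgroup : normal_subgroup G :=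
  @NormalSubgroup G (generated commutators) (generated1 _)
    (@generatedM _ _) (@generatedV _ _) generated_commutatorsJ.

Definition abelianization := quotient_group commutator_subgroup.
HB.instance Definition _ := Group.on abelianization.

Definition abel : G -> abelianization := @quotient_proj G commutator_subgroup.

Lemma abelM : {morph abel : x y / (x * y)%g}.
Proof. by move=> x y; rewrite /abel gmulfM. Qed.

Lemma abelianization_mulC : commutative (fun x y : abelianization => x * y)%g.
Proof.
elim/quotient_groupW => x; elim/quotient_groupW => y; rewrite -!gmulfM.
apply/quotient_projP; apply: generated_in; exists y, x.
by rewrite invgM commgEl conjgE !mulgA.
Qed.

Let abelianizationJ (x y : abelianization) : (x ^ y = x)%g.
Proof. by rewrite conjgE (abelianization_mulC x y) mulKg. Qed.

(* every subgroup of an abelian group is normal *)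
Definition abelian_subgroup (S : set abelianization)
    (S1 : S 1%g) (SM : forall x y, S x -> S y -> S (x * y)%g)
    (SV : forall x, S x -> S (x^-1)%g) : normal_subgroup abelianization :=
  NormalSubgroup S1 SM SV
    (fun x y Sx => eq_ind_r S Sx (abelianizationJ x y)).

Let torsion : set abelianization :=
  [set x | exists2 m, (0 < m)%N & (x ^+ m = 1)%g].

Let torsion1 : torsion 1%g.
Proof. by exists 1%N. Qed.

Let torsionM x y : torsion x -> torsion y -> torsion (x * y)%g.
Proof.
move=> [m m0 xm] [k k0 yk]; exists (m * k)%N; first by rewrite muln_gt0 m0.
rewrite expgMn; last exact: abelianization_mulC.
by rewrite expgnA xm expg1n mulnC expgnA yk expg1n mulg1.
Qed.

Let torsionV x : torsion x -> torsion (x^-1)%g.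
Proof. by move=> [m m0 xm]; exists m => //; rewrite expVgn xm invg1. Qed.

Definition torsion_subgroup := abelian_subgroup torsion1 torsionM torsionV.

(* the free part [H] of the abelianisation *)
Definition free_part := quotient_group torsion_subgroup.
HB.instance Definition _ := Group.on free_part.

Definition to_free_part (g : G) : free_part := quotient_proj torsion_subgroup (abel g).

Lemma to_free_partM : {morph to_free_part : g h / (g * h)%g}.
Proof. by move=> g h; rewrite /to_free_part abelM gmulfM. Qed.

End Abelianization.

Section StableGL.
Variable R : pzRingType.

Definition invertible_mx n (A : 'M[R]_n) : Prop :=
  exists B : 'M[R]_n, A *m B = 1%:M /\ B *m A = 1%:M.

(* diag(A, 1, 1, 1, ...) as an infinite matrix *)
Definition stabilize n (A : 'M[R]_n) : nat -> nat -> R := fun i j =>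
  if insub i is Some i' then if insub j is Some j' then A i' j'
  else (i == j)%:R else (i == j)%:R.

Definition stably_invertible (f : nat -> nat -> R) : bool :=
  `[< exists n (A : 'M[R]_n), invertible_mx A /\ f = stabilize A >].

(* [GL(R)], the union of the [GL_n(R)] *)
Record GL := MkGL { GL_val :> nat -> nat -> R; _ : stably_invertible GL_val }.
HB.instance Definition _ := [isSub for GL_val].
HB.instance Definition _ := [Choice of GL by <:].

Lemma GL_of_subproof n (A : 'M[R]_n) : invertible_mx A ->
  stably_invertible (stabilize A).
Proof. by move=> hA; apply/asboolP; exists n, A. Qed.

Definition GL_of n (A : 'M[R]_n) (hA : invertible_mx A) : GL :=
  MkGL (GL_of_subproof hA).

Lemma stabilizeE n (A : 'M[R]_n) (i j : 'I_n) : stabilize A i j = A i j.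
Proof. by rewrite /stabilize !valK. Qed.

Lemma stabilize_out n (A : 'M[R]_n) i j : (n <= i)%N || (n <= j)%N ->
  stabilize A i j = (i == j)%:R.
Proof.
rewrite /stabilize; case: insubP => // i' _ <-; case: insubP => // j' _ <-.
by rewrite leqNgt ltn_ord leqNgt ltn_ord.
Qed.

Definition truncate m (f : nat -> nat -> R) : 'M[R]_m := \matrix_(i, j) f i j.

Lemma truncateK n (A : 'M[R]_n) m : (n <= m)%N ->
  stabilize (truncate m (stabilize A)) = stabilize A.
Proof.
move=> nm; apply/funext => i; apply/funext => j.
have [im|im] := ltnP i m; last first.
  by rewrite !stabilize_out ?im // (leq_trans nm im).
have [jm|jm] := ltnP j m; last first.
  by rewrite !stabilize_out ?jm ?orbT // (leq_trans nm jm) orbT.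
by have := stabilizeE (truncate m (stabilize A)) (Ordinal im) (Ordinal jm) => /= ->;
  rewrite mxE.
Qed.

Lemma stabilizeK n : cancel (@stabilize n) (truncate n).
Proof. by move=> A; apply/matrixP => i j; rewrite mxE stabilizeE. Qed.

Lemma truncate1 n m : truncate m (stabilize (1%:M : 'M[R]_n)) = 1%:M.
Proof.
apply/matrixP => i j; rewrite !mxE.
have [/andP[hi hj]|h] := boolP ((i < n)%N && (j < n)%N).
  by have := stabilizeE 1%:M (Ordinal hi) (Ordinal hj) => /= ->; rewrite !mxE.
by rewrite stabilize_out // (leqNgt n i) (leqNgt n j) -negb_and.
Qed.

Lemma stabilize1 n : stabilize (1%:M : 'M[R]_n) = fun i j => (i == j)%:R.
Proof.
apply/funext => i; apply/funext => j; rewrite /stabilize.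
by case: insubP => // i' _ <-; case: insubP => // j' _ <-; rewrite mxE.
Qed.

(* matrix product; the sum is finitely supported *)
Definition infmx_mul (f g : nat -> nat -> R) : nat -> nat -> R :=
  fun i k => \sum_(j \in [set: nat]) f i j * g j k.

Lemma infmx_mulE n (A B : 'M[R]_n) :
  infmx_mul (stabilize A) (stabilize B) = stabilize (A *m B).
Proof.
apply/funext => i; apply/funext => k; rewrite /infmx_mul.
have [ni|ni] := leqP n i.
  rewrite [RHS]stabilize_out ?ni // -(fsbig_widen [set i]) //=; last first.
    move=> j [_ /= ji]; rewrite stabilize_out ?ni //.
    by case: eqP ji => [->//|_ _]; rewrite mul0r.
  by rewrite fsbig_set1 !stabilize_out ?ni // eqxx mul1r.
rewrite -(fsbig_widen [set j | (j < n)%N]) //=; last first.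
  move=> j [_ /= /negP]; rewrite -leqNgt => nj.
  by rewrite stabilize_out ?nj ?orbT // ltn_eqF ?mul0r // (leq_trans ni nj).
rewrite -fsbig_ord.
have [nk|nk] := leqP n k.
  rewrite [RHS]stabilize_out ?nk ?orbT // (ltn_eqF (leq_trans ni nk)).
  apply: big1 => j _; rewrite [X in _ * X]stabilize_out ?nk ?orbT //.
  by rewrite ltn_eqF ?mulr0 // (leq_trans (ltn_ord j) nk).
have := stabilizeE (A *m B) (Ordinal ni) (Ordinal nk) => /= ->.
rewrite mxE; apply: eq_bigr => j _.
by rewrite -(stabilizeE A) -(stabilizeE B).
Qed.

Lemma invertible_truncate n m (A : 'M[R]_n) : (n <= m)%N -> invertible_mx A ->
  invertible_mx (truncate m (stabilize A)).
Proof.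
move=> nm [B [AB BA]]; exists (truncate m (stabilize B)).
suff h (C D : 'M[R]_n) : truncate m (stabilize C) *m truncate m (stabilize D)
   = truncate m (stabilize (C *m D)) by rewrite !h AB BA truncate1.
rewrite -[LHS]stabilizeK -infmx_mulE !truncateK // infmx_mulE.
by [].
Qed.

Lemma GLW (P : GL -> Prop) :
  (forall n (A : 'M[R]_n) (hA : invertible_mx A), P (GL_of hA)) -> forall a, P a.
Proof.
move=> h [f hf]; have /asboolP[n [A [hA fE]]] := hf.
by suff -> : MkGL hf = GL_of hA by []; apply: val_inj.
Qed.

Lemma invertible_mulmx n (A B : 'M[R]_n) :
  invertible_mx A -> invertible_mx B -> invertible_mx (A *m B).
Proof.
move=> [A' [AA' A'A]] [B' [BB' B'B]]; exists (B' *m A'); split.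
  by rewrite mulmxA -(mulmxA A) BB' mulmx1.
by rewrite mulmxA -(mulmxA B') A'A mulmx1.
Qed.

Lemma GL_common (a b : GL) : exists n (A B : 'M[R]_n),
  [/\ invertible_mx A, invertible_mx B, GL_val a = stabilize A
    & GL_val b = stabilize B].
Proof.
elim/GLW: a => n A hA; elim/GLW: b => m B hB; exists (maxn n m).
exists (truncate _ (stabilize A)), (truncate _ (stabilize B)).
by split; rewrite ?truncateK ?leq_maxl ?leq_maxr //;
  apply: invertible_truncate; rewrite ?leq_maxl ?leq_maxr.
Qed.

Let GL_mul_subproof (a b : GL) : stably_invertible (infmx_mul a b).
Proof.
have [n [A [B [hA hB -> ->]]]] := GL_common a b; rewrite infmx_mulE.
exact/GL_of_subproof/invertible_mulmx.
Qed.

Definition GL_mul (a b : GL) : GL := MkGL (GL_mul_subproof a b).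

Let GL_one_subproof : stably_invertible (fun i j => (i == j)%:R).
Proof.
rewrite -(stabilize1 0); apply: GL_of_subproof.
by exists 1%:M; rewrite mulmx1.
Qed.

Definition GL_one : GL := MkGL GL_one_subproof.

Let GL_inv_ex (a : GL) : exists b, GL_mul a b = GL_one /\ GL_mul b a = GL_one.
Proof.
elim/GLW: a => n A [B [AB BA]].
have hB : invertible_mx B by exists A.
by exists (GL_of hB); split; apply: val_inj;
  rewrite /= infmx_mulE ?AB ?BA stabilize1.
Qed.

Definition GL_inv (a : GL) : GL := sval (cid (GL_inv_ex a)).

Let GL_mulA : associative GL_mul.
Proof.
move=> a b c; apply: val_inj => /=.
have [n [A [B [hA hB aE bE]]]] := GL_common a b.
move: a b aE bE => [f hf] [g hg] /= {hf hg} -> ->.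
elim/GLW: c => m C hC /=.
rewrite -(truncateK A (leq_maxl n m)) -(truncateK B (leq_maxl n m)).
by rewrite -(truncateK C (leq_maxr n m)) !infmx_mulE mulmxA.
Qed.

Let GL_mul1 : left_id GL_one GL_mul.
Proof.
elim/GLW => n A hA; apply: val_inj; rewrite /= -(stabilize1 n) infmx_mulE.
by rewrite mul1mx.
Qed.

Let GL_mul1r : right_id GL_one GL_mul.
Proof.
elim/GLW => n A hA; apply: val_inj; rewrite /= -(stabilize1 n) infmx_mulE.
by rewrite mulmx1.
Qed.

Let GL_mulV : left_inverse GL_one GL_inv GL_mul.
Proof. by move=> a; rewrite /GL_inv; case: cid => b []. Qed.

Let GL_mulVr : right_inverse GL_one GL_inv GL_mul.
Proof. by move=> a; rewrite /GL_inv; case: cid => b []. Qed.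

HB.instance Definition _ := isGroup.Build GL
  GL_mulA GL_mul1 GL_mul1r GL_mulV GL_mulVr.

Definition K1 := abelianization GL.
HB.instance Definition _ := Group.on K1.

End StableGL.

(* Coefficients in [B], structure functions
     phi(h)(r) = u(h) r u(h)^-1  and  mu(h, k) = u(h) u(k) u(hk)^-1
   for a map [u] from the group to the units of [B]. The twisted group ring KH
   is the case [u = s], the plain group ring the case [u = 1]. *)
Lemma malgW (B : zmodType) (H : choiceType) (P : {malg B[H]} -> Prop) :
  P 0 -> (forall x y, P x -> P y -> P (x + y)) ->
  (forall a h, P << a *g h >>) -> forall x, P x.
Proof.
move=> P0 PD PU x; rewrite [x]monalgE.
by elim: (enum_fset (msupp x)) => [|h s IH]; rewrite ?big_nil ?big_cons //; exact: PD.
Qed.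

Section TwistedRing.
Variables (B : unitRingType) (H : groupType) (u : H -> B).
Hypothesis u_unit : forall h, u h \is a GRing.unit.

Definition tw_action (h : H) (r : B) : B := u h * r * (u h)^-1.

Definition tw_cocycle (h k : H) : B := u h * u k * (u (h * k)%g)^-1.

Definition twisted_ring of (forall h, u h \is a GRing.unit) := {malg B[H]}.
Local Notation TH := (twisted_ring u_unit).
HB.instance Definition _ := GRing.Zmodule.on TH.

Definition tw_one : TH := << (tw_cocycle 1%g 1%g)^-1 *g 1%g >>.

Definition tw_mul (x y : TH) : TH :=
  \sum_(h <- msupp x) \sum_(k <- msupp y)
    << x@_h * tw_action h y@_k * tw_cocycle h k *g (h * k)%g >>.

Let term (h k : H) (a b : B) : TH :=
  << a * tw_action h b * tw_cocycle h k *g (h * k)%g >>.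

Let termE h k a b :
  term h k a b = << a * u h * b * u k * (u (h * k)%g)^-1 *g (h * k)%g >>.
Proof.
congr << _ *g _ >>; rewrite /tw_action /tw_cocycle !mulrA.
by rewrite -[_ / u h * u h]mulrA mulVr // mulr1.
Qed.

Let term0l h k b : term h k 0 b = 0.
Proof. by rewrite /term !mul0r monalgU0. Qed.

Let term0r h k a : term h k a 0 = 0.
Proof. by rewrite /term /tw_action mulr0 mul0r mulr0 mul0r monalgU0. Qed.

Let termDl h k a a' b : term h k (a + a') b = term h k a b + term h k a' b.
Proof. by rewrite /term !mulrDl monalgUD. Qed.

Let termDr h k a b b' : term h k a (b + b') = term h k a b + term h k a b'.
Proof. by rewrite !termE mulrDr !mulrDl monalgUD. Qed.

Let mulw (d e : {fset H}) (x y : TH) : (msupp x `<=` d)%fset -> (msupp y `<=` e)%fset ->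
  tw_mul x y = \sum_(h <- d) \sum_(k <- e) term h k x@_h y@_k.
Proof.
move=> xd ye; rewrite /tw_mul (big_fset_incl _ xd) /=; last first.
  move=> h _ /mcoeff_outdom xh; apply: big1_seq => k _.
  by rewrite xh; exact: term0l.
apply: eq_bigr => h _; apply: (big_fset_incl _ ye) => k _ /mcoeff_outdom yk.
by rewrite yk; exact: term0r.
Qed.

Let tw_mulDl : left_distributive tw_mul +%R.
Proof.
move=> x y z; pose d := (msupp x `|` msupp y)%fset.
rewrite (@mulw d (msupp z) x) ?fsubsetUl // (@mulw d (msupp z) y) ?fsubsetUr //.
rewrite (@mulw d (msupp z)) ?msuppD_le // -big_split; apply: eq_bigr => h _ /=.
rewrite -big_split; apply: eq_bigr => k _ /=.
by rewrite mcoeffD termDl.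
Qed.

Let tw_mulDr : right_distributive tw_mul +%R.
Proof.
move=> x y z; pose d := (msupp y `|` msupp z)%fset.
rewrite (@mulw (msupp x) d x y) ?fsubsetUl // (@mulw (msupp x) d x z) ?fsubsetUr //.
rewrite (@mulw (msupp x) d) ?msuppD_le // -big_split; apply: eq_bigr => h _ /=.
rewrite -big_split; apply: eq_bigr => k _ /=.
by rewrite mcoeffD termDr.
Qed.

Let tw_mulU a b h k : tw_mul << a *g h >> << b *g k >> =
  << a * tw_action h b * tw_cocycle h k *g (h * k)%g >>.
Proof. by rewrite (mulw msuppU_le msuppU_le) !big_seq_fset1 !mcoeffUU. Qed.

Let tw_mul0l y : tw_mul 0 y = 0.
Proof. by rewrite /tw_mul msupp0 big_seq_fset0. Qed.

Let tw_mul0r y : tw_mul y 0 = 0.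
Proof. by apply: (@addIr _ (tw_mul y 0)); rewrite -tw_mulDr !addr0 add0r. Qed.

Let tw_mulA : associative tw_mul.
Proof.
move=> x y z; elim/malgW: x => [|x x' ex ex'|a h].
- by rewrite !tw_mul0l.
- by rewrite !tw_mulDl ex ex'.
elim/malgW: y => [|y y' ey ey'|b k].
- by rewrite !(tw_mul0l, tw_mul0r).
- by rewrite !(tw_mulDl, tw_mulDr) ey ey'.
elim/malgW: z => [|z z' ez ez'|c l].
- by rewrite !tw_mul0r.
- by rewrite !tw_mulDr ez ez'.
rewrite !tw_mulU -!/(term _ _ _ _) !termE mulgA; congr << _ *g _ >>.
rewrite -!/(tw_action _ _) /tw_action /tw_cocycle !mulrA.
by do 10?rewrite mulrVK //.
Qed.

Let tw_mul1l : left_id tw_one tw_mul.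
Proof.
elim/malgW => [|x x' ex ex'|a h].
- exact: tw_mul0r.
- by rewrite tw_mulDr ex ex'.
rewrite tw_mulU -/(term _ _ _ _) termE !mul1g /tw_cocycle; congr << _ *g _ >>.
by rewrite mul1g !mulrK // mulVr // mul1r.
Qed.

Let tw_mul1r : right_id tw_one tw_mul.
Proof.
elim/malgW => [|x x' ex ex'|a h].
- exact: tw_mul0l.
- by rewrite tw_mulDl ex ex'.
rewrite tw_mulU -/(term _ _ _ _) termE !mulg1 /tw_cocycle; congr << _ *g _ >>.
by rewrite mul1g mulrK // mulrVK // mulrK.
Qed.

Let tw_one_neq0 : tw_one != 0.
Proof.
rewrite /tw_one monalgU_eq0 invr_eq0 /tw_cocycle mul1g mulrK //.
by apply: contraTneq (u_unit 1%g) => ->; rewrite unitr0.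
Qed.

HB.instance Definition _ := GRing.Zmodule_isNzRing.Build TH
  tw_mulA tw_mul1l tw_mul1r tw_mulDl tw_mulDr tw_one_neq0.

Lemma twisted_ringU a b h k : (<< a *g h >> : TH) * (<< b *g k >> : TH) =
  << a * tw_action h b * tw_cocycle h k *g (h * k)%g >>.
Proof. exact: tw_mulU. Qed.

End TwistedRing.

Section GroupRing.
Variable G : groupType.

Let one_unit (g : G) : (1 : int) \is a GRing.unit.
Proof. exact: unitr1. Qed.

(* the integral group ring [ZG] *)
Definition group_ring := twisted_ring one_unit.
HB.instance Definition _ := GRing.NzRing.on group_ring.

Definition gring (g : G) : group_ring := << 1 *g g >>.

Lemma group_ringU (a b : int) (g h : G) :
  (<< a *g g >> : group_ring) * (<< b *g h >> : group_ring) =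
  << a * b *g (g * h)%g >>.
Proof.
rewrite /group_ring twisted_ringU /tw_action /tw_cocycle.
by rewrite !mul1r invr1 !mulr1.
Qed.

Lemma gringM : {morph gring : g h / (g * h)%g >-> g * h}.
Proof. by move=> g h; rewrite group_ringU mulr1. Qed.

Lemma gring1 : gring 1%g = 1.
Proof.
by congr (<< _ *g _ >> : {malg int[G]}); rewrite /tw_cocycle !mul1r !invr1.
Qed.

Lemma gringK g : gring g * gring g^-1%g = 1.
Proof. by rewrite -gringM mulgV gring1. Qed.

Lemma gringVK g : gring g^-1%g * gring g = 1.
Proof. by rewrite -gringM mulVg gring1. Qed.

End GroupRing.

Definition skew_field (K : unitRingType) : Prop :=
  forall x : K, x != 0 -> x \is a GRing.unit.

Lemma morphD_zmod (U V : zmodType) (f : U -> V) :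
  {morph f : x y / x + y} -> zmod_morphism f.
Proof. by move=> fD x y; apply: (@addIr _ (f y)); rewrite -fD !subrK. Qed.

Section TwistedKH.
Variables (G : groupType) (K : unitRingType) (j : {rmorphism group_ring G -> K}).
Variable s : free_part G -> G.

Definition section_value (h : free_part G) : K := j (gring (s h)).

Let j_unit g : j (gring g) \is a GRing.unit.
Proof.
apply/unitrP; exists (j (gring g^-1%g)).
by rewrite -!rmorphM gringK gringVK rmorph1.
Qed.

Lemma section_value_unit h : section_value h \is a GRing.unit.
Proof. exact: j_unit. Qed.

(* the twisted group ring [KH] *)
Definition KH := twisted_ring section_value_unit.
HB.instance Definition _ := GRing.NzRing.on KH.

(* g = (g s(h)^-1) h, for h the image of g *)
Definition group_ring_to_KH (x : group_ring G) : KH :=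
  \sum_(g <- msupp x)
    << (x@_g)%:~R * j (gring (g * (s (to_free_part g))^-1)%g)
       *g to_free_part g >>.

Let toKHw (d : {fset G}) (x : group_ring G) : (msupp x `<=` d)%fset ->
  group_ring_to_KH x = \sum_(g <- d)
    << (x@_g)%:~R * j (gring (g * (s (to_free_part g))^-1)%g)
       *g to_free_part g >>.
Proof.
move=> xd; apply: (big_fset_incl _ xd) => g _ /mcoeff_outdom ->.
by rewrite mul0r monalgU0.
Qed.

Let toKHU (a : int) g : group_ring_to_KH << a *g g >> =
  << a%:~R * j (gring (g * (s (to_free_part g))^-1)%g) *g to_free_part g >>.
Proof. by rewrite (toKHw msuppU_le) big_seq_fset1 mcoeffUU. Qed.

Let toKHD : {morph group_ring_to_KH : x y / x + y}.
Proof.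
move=> x y; pose d := (msupp x `|` msupp y)%fset.
rewrite (@toKHw d x) ?fsubsetUl // (@toKHw d y) ?fsubsetUr //.
rewrite (@toKHw d) ?msuppD_le // -big_split; apply: eq_bigr => g _ /=.
by rewrite mcoeffD rmorphD mulrDl monalgUD.
Qed.

Let toKH0 : group_ring_to_KH 0 = 0.
Proof. by apply: (@addIr _ (group_ring_to_KH 0)); rewrite -toKHD !add0r. Qed.

Let toKHB : zmod_morphism group_ring_to_KH.
Proof. exact: morphD_zmod. Qed.

Let jV g : j (gring g^-1%g) = (j (gring g))^-1.
Proof.
apply: (mulrI (j_unit g)).
by rewrite -rmorphM gringK rmorph1 mulrV.
Qed.

Let toKH1 : group_ring_to_KH 1 = 1.
Proof.
have f1 : to_free_part (1 : G)%g = 1%g.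
  by apply: (@mulgI _ (to_free_part 1%g)); rewrite -to_free_partM !mulg1.
rewrite -gring1 /gring toKHU mul1r mul1g jV f1; congr << _ *g _ >>.
by rewrite /tw_cocycle mul1g mulrK // section_value_unit.
Qed.

Let toKHM : {morph group_ring_to_KH : x y / x * y}.
Proof.
move=> x y; elim/malgW: x => [|x x' ex ex'|a g].
- by rewrite !(mul0r, toKH0).
- by rewrite mulrDl !toKHD mulrDl ex ex'.
elim/malgW: y => [|y y' ey ey'|b h].
- by rewrite !(mulr0, toKH0).
- by rewrite mulrDr !toKHD mulrDr ey ey'.
rewrite group_ringU !toKHU twisted_ringU to_free_partM; congr << _ *g _ >>.
rewrite /tw_action /tw_cocycle /section_value intrM.
set g' := to_free_part g; set h' := to_free_part h.
rewrite !gringM !rmorphM !jV !mulrA.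
rewrite !mulrVK ?section_value_unit //.
have bC (r : K) : r * b%:~R = b%:~R * r by exact: commr_int.
by rewrite -(mulrA a%:~R (j (gring g))) (bC (j _)) !mulrA.
Qed.

HB.instance Definition _ := GRing.isZmodMorphism.Build _ _ group_ring_to_KH toKHB.
HB.instance Definition _ := GRing.isMonoidMorphism.Build _ _ group_ring_to_KH
  (conj toKH1 toKHM).

End TwistedKH.

Section Polytopes.
Variable R : realType.

Definition dot m (a x : 'rV[R]_m) : R := \sum_i a 0 i * x 0 i.

Definition polyhedron m (s : seq ('rV[R]_m * R)) : set 'rV[R]_m :=
  [set x | forall c, c \in s -> dot c.1 x <= c.2].

Definition is_polytope m (P : set 'rV[R]_m) : Prop :=
  compact P /\ exists s, P = polyhedron s.

Definition face m (P : set 'rV[R]_m) (a : 'rV[R]_m) : set 'rV[R]_m :=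
  [set x | P x /\ forall y, P y -> dot a x <= dot a y].

(* zero-dimensional faces *)
Definition is_vertex m (P : set 'rV[R]_m) (v : 'rV[R]_m) : Prop :=
  exists a, face P a = [set v].

Definition lattice_point m (z : 'rV[int]_m) : 'rV[R]_m := map_mx intr z.

Definition is_integral m (P : set 'rV[R]_m) : Prop :=
  forall v, is_vertex P v -> exists z, v = lattice_point z.

Definition minkowski_sum m (P Q : set 'rV[R]_m) : set 'rV[R]_m :=
  [set x + y | x in P & y in Q].

Definition convex_hull m (S : set 'rV[R]_m) : set 'rV[R]_m :=
  [set x | exists k (t : 'rV[R]_k) (p : 'I_k -> 'rV[R]_m),
    [/\ forall i, 0 <= t 0 i, \sum_i t 0 i = 1, forall i, S (p i)
      & x = \sum_i t 0 i *: p i]].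

Lemma dotC m (a x : 'rV[R]_m) : dot a x = dot x a.
Proof. by apply: eq_bigr => i _; rewrite mulrC. Qed.

Lemma dotDr m (a x y : 'rV[R]_m) : dot a (x + y) = dot a x + dot a y.
Proof. by rewrite -big_split; apply: eq_bigr => i _; rewrite mxE mulrDr. Qed.

Lemma dotDl m (a x y : 'rV[R]_m) : dot (x + y) a = dot x a + dot y a.
Proof. by rewrite dotC dotDr !(dotC a). Qed.

Lemma dotZr m c (a x : 'rV[R]_m) : dot a (c *: x) = c * dot a x.
Proof. by rewrite mulr_sumr; apply: eq_bigr => i _; rewrite mxE mulrCA. Qed.

Lemma dotZl m c (a x : 'rV[R]_m) : dot (c *: x) a = c * dot x a.
Proof. by rewrite dotC dotZr dotC. Qed.

Lemma dotNl m (a x : 'rV[R]_m) : dot (- x) a = - dot x a.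
Proof. by rewrite -scaleN1r dotZl mulN1r. Qed.

Lemma dotNr m (a x : 'rV[R]_m) : dot a (- x) = - dot a x.
Proof. by rewrite dotC dotNl dotC. Qed.

Lemma dot0l m (x : 'rV[R]_m) : dot 0 x = 0.
Proof. by apply: big1 => i _; rewrite mxE mul0r. Qed.

Lemma dot_sumr m (a : 'rV[R]_m) k (F : 'I_k -> 'rV[R]_m) :
  dot a (\sum_i F i) = \sum_i dot a (F i).
Proof.
rewrite /dot exchange_big; apply: eq_bigr => i _ /=.
by rewrite summxE mulr_sumr.
Qed.

Lemma dot_row m k (a x : 'rV[R]_m) (b y : 'rV[R]_k) :
  dot (row_mx a b) (row_mx x y) = dot a x + dot b y.
Proof.
by rewrite /dot big_split_ord; congr (_ + _); apply: eq_bigr => i _;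
  rewrite ?row_mxEl ?row_mxEr.
Qed.

Lemma dot_rowr m k (a : 'rV[R]_(m + k)) (x : 'rV[R]_m) (y : 'rV[R]_k) :
  dot a (row_mx x y) = dot (lsubmx a) x + dot (rsubmx a) y.
Proof. by rewrite -dot_row hsubmxK. Qed.

Lemma dot1 (a x : 'rV[R]_1) : dot a x = a 0 0 * x 0 0.
Proof. by rewrite /dot big_ord1. Qed.

Lemma between_seq (L U : seq R) : (forall l u, l \in L -> u \in U -> l <= u) ->
  exists t, (forall l, l \in L -> l <= t) /\ (forall u, u \in U -> t <= u).
Proof.
elim: L => [_|l L IH h].
  elim: U => [|u U [t [_ ht]]]; first by exists 0.
  exists (Num.min u t); split=> // v; rewrite inE => /orP[/eqP->|/ht tv].
    by rewrite ge_min lexx.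
  by rewrite ge_min tv orbT.
have [t [h1 h2]] := IH (fun l' u hl' => h l' u (mem_behead (s := l :: L) hl')).
exists (Num.max l t); split=> [l'|u hu].
  rewrite inE => /orP[/eqP->|/h1 lt]; first by rewrite le_max lexx.
  by rewrite le_max lt orbT.
by rewrite ge_max h2 // h // mem_head.
Qed.

Lemma eliminate1 m (s : seq ('rV[R]_m * R * R)) :
  exists s', polyhedron s' =
    [set x | exists t, forall c, c \in s -> dot c.1.1 x + c.1.2 * t <= c.2].
Proof.
pose Z := [seq (c.1.1, c.2) | c <- s & c.1.2 == 0].
pose N := [seq (c.1.2^-1 *: c.1.1, c.2 / c.1.2) | c <- s & c.1.2 < 0].
pose P := [seq (c.1.2^-1 *: c.1.1, c.2 / c.1.2) | c <- s & 0 < c.1.2].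
exists (Z ++ [seq (p.1 - n.1, p.2 - n.2) | n <- N, p <- P]).
apply/seteqP; split=> x /=.
  move=> h.
  have [t [hL hU]] : exists t,
      (forall l, l \in [seq n.2 - dot n.1 x | n <- N] -> l <= t) /\
      (forall u, u \in [seq p.2 - dot p.1 x | p <- P] -> t <= u).
    apply: between_seq => _ _ /mapP[n nN ->] /mapP[p pP ->].
    have /= := h (p.1 - n.1, p.2 - n.2).
    rewrite mem_cat allpairs_f ?orbT // => /(_ isT).
    by rewrite dotDl dotNl; lra.
  exists t => -[[a e] b] cs /=.
  have [e0|e0|e0] := ltgtP e 0.
  - have /hL /= : b / e - dot (e^-1 *: a) x \in [seq n.2 - dot n.1 x | n <- N].
      apply/mapP; exists (e^-1 *: a, b / e) => //.
      by apply/mapP; exists ((a, e), b); rewrite // mem_filter /= e0.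
    rewrite dotZl mulrC -mulrBr mulrC ler_ndivrMr //; lra.
  - have /hU /= : b / e - dot (e^-1 *: a) x \in [seq n.2 - dot n.1 x | n <- P].
      apply/mapP; exists (e^-1 *: a, b / e) => //.
      by apply/mapP; exists ((a, e), b); rewrite // mem_filter /= e0.
    rewrite dotZl mulrC -mulrBr mulrC ler_pdivlMr //; lra.
  - have /= := h (a, b); rewrite mem_cat e0 mul0r addr0; apply.
    apply/orP; left; apply/mapP; exists ((a, e), b) => //.
    by rewrite mem_filter /= cs e0 eqxx.
move=> [t ht] [a b]; rewrite mem_cat => /orP[/mapP[[[a' e] b']]|].
  rewrite mem_filter /= => /andP[/eqP-> /ht /=] + [-> ->].
  by rewrite mul0r addr0.
move=> /allpairsP[[[n1 n2] [p1 p2]] /= [/mapP[[[a1 e1] b1]]]].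
rewrite mem_filter /= => /andP[e1n /ht /= h1] [-> ->].
move=> /mapP[[[a2 e2] b2]]; rewrite mem_filter /= => /andP[e2p /ht /= h2] [-> ->].
move=> [-> ->]; rewrite dotDl dotNl !dotZl.
have : b1 / e1 - e1^-1 * dot a1 x <= t.
  by rewrite mulrC -mulrBr mulrC ler_ndivrMr //; lra.
have : t <= b2 / e2 - e2^-1 * dot a2 x.
  by rewrite mulrC -mulrBr mulrC ler_pdivlMr //; lra.
lra.
Qed.

Lemma eliminate m k (s : seq ('rV[R]_m * 'rV[R]_k * R)) :
  exists s', polyhedron s' =
    [set x | exists y, forall c, c \in s -> dot c.1.1 x + dot c.1.2 y <= c.2].
Proof.
elim: k => [|k IH] in m s *; last move: s; last first.
  change (forall s : seq ('rV[R]_m * 'rV[R]_(1 + k) * R),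
    exists s', polyhedron s' = [set x | exists y : 'rV[R]_(1 + k),
      forall c, c \in s -> dot c.1.1 x + dot c.1.2 y <= c.2]) => s.
pose f (c : 'rV[R]_m * 'rV[R]_(1 + k) * R) :=
  (row_mx c.1.1 (lsubmx c.1.2), rsubmx c.1.2, c.2).
have [s1 s1E] := IH (m + 1)%N [seq f c | c <- s].
pose g (c : 'rV[R]_(m + 1) * R) := (lsubmx c.1, rsubmx c.1 0 0, c.2).
have [s2 s2E] := eliminate1 [seq g c | c <- s1].
exists s2; rewrite s2E; apply/seteqP; split=> x /=.
  move=> [t h].
  have : polyhedron s1 (row_mx x (const_mx t)).
    move=> c cs; have /= := h (g c) (map_f _ cs).
    by rewrite dot_rowr dot1 [const_mx _ _ _]mxE.
  rewrite s1E => -[y hy]; exists (row_mx (const_mx t : 'rV_1) y : 'rV_(1 + k)) => c cs.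
  have /= := hy (f c) (map_f _ cs); rewrite dot_row.
  by rewrite -addrA -[X in _ + X]dot_row hsubmxK.
move=> [y h]; exists (lsubmx (y : 'rV_(1 + k)) 0 0) => _ /mapP[c cs ->] /=.
have : polyhedron s1 (row_mx x (lsubmx (y : 'rV_(1 + k)))).
  rewrite s1E; exists (rsubmx (y : 'rV_(1 + k))) => _ /mapP[d ds ->] /=.
  rewrite dot_row -addrA -[X in _ + X]dot_row !hsubmxK; exact: h.
by move=> /(_ c cs); rewrite dot_rowr dot1.
exists [seq (c.1.1, c.2) | c <- s]; apply/seteqP; split=> x /=.
  move=> h; exists 0 => c cs; rewrite [dot c.1.2 _]big_ord0 addr0.
  by apply: (h (c.1.1, c.2)); apply/mapP; exists c.
move=> [y h] _ /mapP[c cs ->] /=.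
by have := h c cs; rewrite [dot c.1.2 _]big_ord0 addr0.
Qed.

Lemma minkowski_compact m (P Q : set 'rV[R]_m) : compact P -> compact Q ->
  compact (minkowski_sum P Q).
Proof.
move=> cP cQ; have -> : minkowski_sum P Q = (fun z => z.1 + z.2) @` (P `*` Q).
  apply/seteqP; split=> [_ [x Px [y Qy <-]]|_ [[x y] [Px Qy] <-]].
    by exists (x, y).
  by exists x => //; exists y.
apply: continuous_compact; last exact: compact_setX.
exact/continuous_subspaceT/add_continuous.
Qed.

Lemma minkowski_polytope m (P Q : set 'rV[R]_m) : is_polytope P ->
  is_polytope Q -> is_polytope (minkowski_sum P Q).
Proof.
move=> [cP [s sP]] [cQ [s' sQ]]; split; first exact: minkowski_compact.
pose f (c : 'rV[R]_m * R) := (c.1, - c.1, c.2).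
pose g (c : 'rV[R]_m * R) := (0 : 'rV[R]_m, c.1, c.2).
have [w wE] := eliminate ([seq f c | c <- s] ++ [seq g c | c <- s']).
exists w; rewrite wE sP sQ; apply/seteqP; split=> [_ [x Px [y Qy <-]]|x /= [y h]].
  exists y => c; rewrite mem_cat => /orP[] /mapP[d ds ->] /=.
    by rewrite dotDr dotNl addrK; exact: Px.
  by rewrite dot0l add0r; exact: Qy.
exists (x - y) => [c cs|].
  have /= := h (f c); rewrite mem_cat map_f // => /(_ isT).
  by rewrite dotNl dotDr dotNr.
exists y; last by rewrite subrK.
move=> c cs; have /= := h (g c); rewrite mem_cat map_f ?orbT // => /(_ isT).
by rewrite dot0l add0r.
Qed.

Lemma minkowski_vertex m (P Q : set 'rV[R]_m) v :
  is_vertex (minkowski_sum P Q) v ->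
  exists x y, [/\ is_vertex P x, is_vertex Q y & v = x + y].
Proof.
move=> [a av]; have : [set v] v by []; rewrite -av => -[[x Px [y Qy xyv]] vmin].
have xmin z : P z -> dot a x <= dot a z.
  move=> Pz; have /vmin : minkowski_sum P Q (z + y) by exists z => //; exists y.
  by rewrite -xyv !dotDr lerD2r.
have ymin z : Q z -> dot a y <= dot a z.
  move=> Qz; have /vmin : minkowski_sum P Q (x + z) by exists x => //; exists z.
  by rewrite -xyv !dotDr lerD2l.
have face_sum z w : face P a z -> face Q a w -> z + w = v.
  move=> [Pz zmin] [Qw wmin]; suff : face (minkowski_sum P Q) a (z + w) by rewrite av.
  split; first by exists z => //; exists w.
  move=> _ [z' Pz' [w' Qw' <-]]; rewrite !dotDr.
  by apply: lerD; [exact: zmin|exact: wmin].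
exists x, y; split=> //.
- exists a; apply/seteqP; split=> [z fz|_ ->]; last by split.
  by apply: (@addIr _ y); rewrite xyv; apply: face_sum.
- exists a; apply/seteqP; split=> [z fz|_ ->]; last by split.
  by apply: (@addrI _ x); rewrite xyv; apply: face_sum.
Qed.

Lemma minkowski_integral m (P Q : set 'rV[R]_m) : is_integral P ->
  is_integral Q -> is_integral (minkowski_sum P Q).
Proof.
move=> iP iQ v /minkowski_vertex[x [y [/iP[z ->] /iQ[w ->] ->]]].
by exists (z + w); rewrite /lattice_point map_mxD.
Qed.

Let combination m k (p : 'I_k -> 'rV[R]_m) (t : 'rV[R]_k) := \sum_i t 0 i *: p i.

Let simplex k : set 'rV[R]_k :=
  [set t | (forall i, 0 <= t 0 i) /\ \sum_i t 0 i = 1].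

Lemma convex_hull_seq m (e : seq 'rV[R]_m) :
  convex_hull [set` e] =
  combination (fun i : 'I_(size e) => e`_i) @` @simplex (size e).
Proof.
apply/seteqP; split=> [x [k [t [p [t0 t1 pe ->]]]]|_ [t [t0 t1] <-]]; last first.
  exists (size e), t, (fun i : 'I_(size e) => e`_i).
  by split=> // i; rewrite /= mem_nth.
have idx i : (index (p i) e < size e)%N by rewrite index_mem; exact: pe.
pose r i := Ordinal (idx i).
exists (\row_j \sum_(i | r i == j) t 0 i).
  split=> [j|]; first by rewrite mxE; apply: sumr_ge0.
  rewrite -t1 [RHS](partition_big r xpredT) //=.
  by apply: eq_bigr => j _; rewrite mxE.
rewrite [RHS](partition_big r xpredT) //=.
apply: eq_bigr => j _; rewrite mxE scaler_suml; apply: eq_bigr => i /eqP <-.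
by rewrite nth_index //; exact: pe.
Qed.

Lemma combination_continuous m k (p : 'I_k -> 'rV[R]_m) :
  continuous (combination p).
Proof.
apply: continuous_big => [z|i _ t]; first exact: add_continuous.
exact: (cvgZr_tmp (@coord_continuous R 1 k 0 i t)).
Qed.

Lemma simplex_compact k : compact (@simplex k).
Proof.
have c1 : closed (\bigcap_i [set t : 'rV[R]_k | 0 <= t 0 i]).
  apply: closed_bigI => i _.
  by apply: (preimage_closed _ (@closed_ge _ 0)) => t _; exact: coord_continuous.
have c2 : closed [set t : 'rV[R]_k | \sum_i t 0 i = 1].
  have h : continuous (fun t : 'rV[R]_k => \sum_i t 0 i).
    apply: continuous_big => [z|i _]; first exact: add_continuous.
    exact: coord_continuous.
  by apply: (preimage_closed _ (@closed_eq _ 1)) => t _; exact: h.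
have simplexE : @simplex k = (\bigcap_i [set t : 'rV[R]_k | 0 <= t 0 i]) `&`
    [set t : 'rV[R]_k | \sum_i t 0 i = 1].
  by apply/seteqP; split=> t [h1 h2]; split=> // i; [move=> _|]; exact: h1.
pose box : set 'rV[R]_k := [set t : 'rV[R]_k | forall i, `[0, 1]%classic (t ord0 i)].
have sub : @simplex k `<=` box.
  move=> t [t0 t1] i; rewrite /= in_itv /= t0 /= -t1.
  by rewrite (bigD1 i) //= lerDl sumr_ge0.
apply: subclosed_compact sub.
  by rewrite simplexE; exact: closedI.
exact: (@rV_compact R k (fun=> `[0, 1]%classic) (fun=> @segment_compact R 0 1)).
Qed.

Lemma convex_hull_polytope m (e : seq 'rV[R]_m) : is_polytope (convex_hull [set` e]).
Proof.
rewrite convex_hull_seq; split.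
  apply: continuous_compact; last exact: simplex_compact.
  exact/continuous_subspaceT/combination_continuous.
pose k := size e; pose p (i : 'I_k) := e`_i.
pose E : seq ('rV[R]_m * 'rV[R]_k * R) :=
  [seq (delta_mx 0 l, - \row_i p i 0 l, 0) | l <- enum 'I_m].
pose E' : seq ('rV[R]_m * 'rV[R]_k * R) :=
  [seq (- delta_mx 0 l, \row_i p i 0 l, 0) | l <- enum 'I_m].
pose T : seq ('rV[R]_m * 'rV[R]_k * R) :=
  [seq (0, - delta_mx 0 i, 0) | i <- enum 'I_k].
pose S : seq ('rV[R]_m * 'rV[R]_k * R) :=
  [:: (0, const_mx 1, 1); (0, - const_mx 1, - 1)].
have dot_delta q (i : 'I_q) (y : 'rV[R]_q) : dot (delta_mx 0 i) y = y 0 i.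
  rewrite /dot (bigD1 i) //= mxE !eqxx mul1r big1 ?addr0 // => i' ne.
  by rewrite mxE eqxx (negbTE ne) mul0r.
have dot_row_p l (y : 'rV[R]_k) : dot (\row_i p i 0 l) y = (combination p y) 0 l.
  by rewrite /dot /combination summxE; apply: eq_bigr => i _; rewrite !mxE mulrC.
have dot_one (y : 'rV[R]_k) : dot (const_mx 1) y = \sum_i y 0 i.
  by apply: eq_bigr => i _; rewrite mxE mul1r.
have [w wE] := eliminate (E ++ E' ++ T ++ S).
exists w; rewrite wE; apply/seteqP; split=> [_ [t [t0 t1] <-]|x [t h]].
  exists t => c; rewrite !mem_cat => /or4P[/mapP[l _ ->]|/mapP[l _ ->]|/mapP[l _ ->]|] /=.
  - by rewrite dotNl dot_delta dot_row_p subrr.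
  - by rewrite dotNl dot_delta dot_row_p addNr.
  - by rewrite dotNl dot0l dot_delta add0r oppr_le0.
  - by rewrite !inE => /orP[]/eqP-> /=; rewrite ?dotNl dot0l dot_one t1 add0r.
exists t.
  split=> [i|].
    have /= := h (0, - delta_mx 0 i, 0); rewrite !mem_cat.
    rewrite (map_f (fun i => (0, - delta_mx 0 i, 0))) ?mem_enum // !orbT.
    by rewrite dotNl dot0l dot_delta add0r oppr_le0 => /(_ isT).
  have /= := h (0, - const_mx 1, - 1); have /= := h (0, const_mx 1, 1).
  rewrite !mem_cat !inE !eqxx !orbT dotNl !dot0l !add0r dot_one.
  move=> /(_ isT) le1 /(_ isT); rewrite lerN2 => ge1.
  by apply/eqP; rewrite eq_le le1.
apply/rowP => l.
have /= := h (delta_mx 0 l, - \row_i p i 0 l, 0).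
have /= := h (- delta_mx 0 l, \row_i p i 0 l, 0).
rewrite !mem_cat (map_f (fun l => (delta_mx 0 l, - \row_i p i 0 l, 0))) ?mem_enum //.
rewrite (map_f (fun l => (- delta_mx 0 l, \row_i p i 0 l, 0))) ?mem_enum // !orbT.
rewrite !dotNl !dot_delta !dot_row_p => /(_ isT) h1 /(_ isT) h2.
by apply/eqP; rewrite eq_le; apply/andP; split; lra.
Qed.

Lemma convex_hull_sub m (S : set 'rV[R]_m) x : S x -> convex_hull S x.
Proof.
move=> Sx; exists 1%N, (const_mx 1), (fun=> x); split=> //.
- by move=> i; rewrite mxE.
- by rewrite big_ord1 mxE.
- by rewrite big_ord1 mxE scale1r.
Qed.

Lemma convex_hull_vertex m (S : set 'rV[R]_m) v : is_vertex (convex_hull S) v -> S v.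
Proof.
move=> [a av]; have : [set v] v by []; rewrite -av => -[[k [t [p [t0 t1 Sp vE]]]] vmin].
have [i ti] : exists i, t 0 i != 0.
  apply: contrapT => /forallNP h; move: t1; rewrite big1 => [/esym/eqP|i _].
    by rewrite oner_eq0.
  by apply/eqP; rewrite -[_ == _]negbK; apply/negP.
suff : face (convex_hull S) a (p i) by rewrite av => <-.
have min_i : dot a (p i) = dot a v.
  apply/eqP; rewrite eq_le vmin ?andbT; last exact/convex_hull_sub/Sp.
  rewrite leNgt; apply/negP => lt.
  have : \sum_j t 0 j * dot a v < \sum_j t 0 j * dot a (p j).
    rewrite [ltLHS](bigD1 i) // [ltRHS](bigD1 i) //=; apply: ltr_leD.
      by rewrite ltr_pM2l // lt_neqAle eq_sym ti t0.
    by apply: ler_sum => j _; apply: ler_wpM2l => //; exact/vmin/convex_hull_sub/Sp.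
  rewrite -mulr_suml t1 mul1r {1}vE dot_sumr.
  by under eq_bigr do rewrite dotZr; rewrite ltxx.
by split=> [|y Sy]; [exact/convex_hull_sub/Sp|rewrite min_i; exact: vmin].
Qed.

End Polytopes.

Section IntegralPolytopes.
Variables (R : realType) (n : nat).

Definition integral_polytope_pred (P : set 'rV[R]_n) : bool :=
  `[< [/\ P !=set0, is_polytope P & is_integral P] >].

Record integral_polytope := IntegralPolytope {
  polytope_set :> set 'rV[R]_n;
  _ : integral_polytope_pred polytope_set }.
HB.instance Definition _ := [isSub for polytope_set].
HB.instance Definition _ := [Choice of integral_polytope by <:].

Let sum_subproof (P Q : integral_polytope) :
  integral_polytope_pred (minkowski_sum P Q).
Proof.
case: P Q => [P /asboolP[[x Px] pP iP]] [Q /asboolP[[y Qy] pQ iQ]] /=.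
apply/asboolP; split; first by exists (x + y); exists x => //; exists y.
  exact: minkowski_polytope.
exact: minkowski_integral.
Qed.

Definition polytope_add (P Q : integral_polytope) : integral_polytope :=
  IntegralPolytope (sum_subproof P Q).

Lemma lattice_hull_subproof (e : seq 'rV[int]_n) : (0 < size e)%N ->
  integral_polytope_pred (convex_hull [set` map (@lattice_point R n) e]).
Proof.
move=> e0; apply/asboolP; split.
- case: e e0 => // z e _; exists (lattice_point R z); apply: convex_hull_sub.
  by rewrite /= mem_head.
- exact: convex_hull_polytope.
- by move=> v /convex_hull_vertex /= /mapP[z _ ->]; exists z.
Qed.

Definition lattice_hull (e : seq 'rV[int]_n) (e0 : (0 < size e)%N) :
  integral_polytope := IntegralPolytope (lattice_hull_subproof e0).

Lemma convex_hull1 (x : 'rV[R]_n) : convex_hull [set x] = [set x].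
Proof.
apply/seteqP; split=> [_ [k [t [p [_ t1 px ->]]]]|_ ->]; last exact: convex_hull_sub.
under eq_bigr => i _ do rewrite (px i : p i = x).
by rewrite -scaler_suml t1 scale1r.
Qed.

Let zero_subproof : integral_polytope_pred [set 0].
Proof.
have -> : [set (0 : 'rV[R]_n)] =
    convex_hull [set` map (@lattice_point R n) [:: 0]].
  have -> : [set` map (@lattice_point R n) [:: 0]] = [set 0].
    have l0 : lattice_point R (0 : 'rV[int]_n) = 0 by exact: raddf0.
    by apply/seteqP; split=> x; rewrite /= inE l0 => /eqP.
  by rewrite convex_hull1.
exact: lattice_hull_subproof.
Qed.

Definition polytope_zero : integral_polytope := IntegralPolytope zero_subproof.

Let polytope_addA : associative polytope_add.
Proof.
move=> P Q S; apply/val_inj/seteqP; split.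
  by move=> _ [x Px [_ [y Qy [z Sz <-]] <-]]; rewrite addrA;
    exists (x + y); [exists x => //; exists y|exists z].
by move=> _ [_ [x Px [y Qy <-]] [z Sz <-]]; rewrite -addrA;
  exists x => //; exists (y + z) => //; exists y => //; exists z.
Qed.

Let polytope_addC : commutative polytope_add.
Proof.
move=> P Q; apply/val_inj/seteqP; split=> _ [x Px [y Qy <-]];
  by exists y => //; exists x => //; rewrite addrC.
Qed.

Let polytope_add0 : left_id polytope_zero polytope_add.
Proof.
move=> P; apply/val_inj/seteqP; split=> [_ [_ -> [x Px <-]]|x Px].
  by rewrite add0r.
by exists 0 => //; exists x => //; rewrite add0r.
Qed.

HB.instance Definition _ := GRing.isNmodule.Build integral_polytope
  polytope_addA polytope_addC polytope_add0.

End IntegralPolytopes.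

Section Grothendieck.
Variable M : nmodType.

Definition groth_rel : rel (M * M) := fun x y =>
  `[< exists c, x.1 + y.2 + c = y.1 + x.2 + c >].

Lemma groth_rel_is_equiv : equiv_class_of groth_rel.
Proof.
split=> [x|x y|y x z]; first by apply/asboolP; exists 0.
  by apply/asboolP/asboolP => -[c h]; exists c.
move=> /asboolP[c h] /asboolP[d k]; apply/asboolP.
exists (y.1 + y.2 + c + d).
rewrite [LHS](AC (2*4) ((1*4*5)*(3*2*6))) /= h k.
by rewrite [LHS](AC (3*3) ((4*2)*(1*5*3*6))).
Qed.
Canonical groth_rel_equiv := EquivRelPack groth_rel_is_equiv.
Canonical groth_rel_encModRel := defaultEncModRel groth_rel.

Definition grothendieck := {eq_quot groth_rel}.
HB.instance Definition _ := Choice.on grothendieck.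
HB.instance Definition _ := EqQuotient.on grothendieck.

Definition formal_diff (a b : M) : grothendieck := \pi_grothendieck (a, b).

Definition groth_class (a : M) : grothendieck := formal_diff a 0.

Lemma formal_diffP a b a' b' : formal_diff a b = formal_diff a' b' <->
  exists c, a + b' + c = a' + b + c.
Proof. by split=> [/eqmodP/asboolP//|h]; apply/eqmodP/asboolP. Qed.

Let gadd (x y : grothendieck) : grothendieck :=
  formal_diff ((repr x).1 + (repr y).1) ((repr x).2 + (repr y).2).
Let gopp (x : grothendieck) : grothendieck := formal_diff (repr x).2 (repr x).1.

Let grothW (P : grothendieck -> Prop) :
  (forall a b, P (formal_diff a b)) -> forall x, P x.
Proof. by move=> h x; rewrite -[x]reprK; case: (repr x) => a b; exact: h. Qed.

Let greprE a b : exists c,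
  (repr (formal_diff a b)).1 + b + c = a + (repr (formal_diff a b)).2 + c.
Proof.
apply/formal_diffP; rewrite -[RHS]reprK; rewrite /formal_diff.
by case: (repr (\pi_grothendieck (a, b))).
Qed.

Let gaddE a b a' b' : gadd (formal_diff a b) (formal_diff a' b') =
  formal_diff (a + a') (b + b').
Proof.
apply/formal_diffP; have [c] := greprE a b; have [d] := greprE a' b'.
case: (repr (formal_diff a b)) (repr (formal_diff a' b')) => [x y] [x' y'] /= k h.
exists (c + d); rewrite [LHS](AC (2*2*2) ((1*3*5)*(2*4*6))) /= h k.
by rewrite [LHS](AC (3*3) ((1*4)*(2*5)*(3*6))).
Qed.

Let goppE a b : gopp (formal_diff a b) = formal_diff b a.
Proof.
apply/formal_diffP; have [c] := greprE a b.
case: (repr _) => [x y] /= h; exists c.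
by rewrite [y + a]addrC -h [x + b]addrC.
Qed.

Let gaddA : associative gadd.
Proof. by elim/grothW => a b; elim/grothW => c d; elim/grothW => e f; rewrite !gaddE !addrA. Qed.
Let gaddC : commutative gadd.
Proof. by elim/grothW => a b; elim/grothW => c d; rewrite !gaddE addrC [b + d]addrC. Qed.
Let gadd0 : left_id (formal_diff 0 0) gadd.
Proof. by elim/grothW => a b; rewrite !gaddE !add0r. Qed.
Let gaddN : left_inverse (formal_diff 0 0) gopp gadd.
Proof.
elim/grothW => a b; rewrite goppE gaddE; apply/formal_diffP.
by exists 0; rewrite !addr0 add0r addrC.
Qed.

HB.instance Definition _ := GRing.isZmodule.Build grothendieck
  gaddA gaddC gadd0 gaddN.

Lemma groth_classB a b : groth_class a - groth_class b = formal_diff a b.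
Proof.
rewrite /groth_class -[- _]/(gopp _) goppE -[_ + _]/(gadd _ _) gaddE.
by rewrite addr0 add0r.
Qed.

Lemma groth_classD : {morph groth_class : a b / a + b}.
Proof.
move=> a b; rewrite /groth_class -[RHS]/(gadd _ _) gaddE.
by rewrite addr0.
Qed.

Lemma groth_class0 : groth_class 0 = 0.
Proof. by []. Qed.

End Grothendieck.

Section PolytopeGroups.
Variables (R : realType) (n : nat).

(* the group [P(H)], for [H = Z^n] *)
Definition polytope_group := grothendieck (integral_polytope R n).
HB.instance Definition _ := GRing.Zmodule.on polytope_group.

Definition polytope_class (P : integral_polytope R n) : polytope_group :=
  groth_class P.

Definition one_point (P : integral_polytope R n) : Prop :=
  exists x, polytope_set P = [set x].

Definition singleton_differences : {pred polytope_group} := fun x =>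
  `[< exists P Q, [/\ one_point P, one_point Q
      & x = polytope_class P - polytope_class Q] >].

Let one_pointD P Q : one_point P -> one_point Q -> one_point (P + Q).
Proof.
move=> [x Px] [y Qy]; exists (x + y); apply/seteqP; split=> [_ [a + [b + <-]]|_ ->].
  by rewrite Px Qy => -> ->.
by exists x; rewrite ?Px //; exists y; rewrite ?Qy.
Qed.

Let singleton_differences_zmod : zmod_closed singleton_differences.
Proof.
split=> [|x y /asboolP[P [Q [hP hQ ->]]] /asboolP[P' [Q' [hP' hQ' ->]]]].
  apply/asboolP; exists 0, 0; split; [by exists 0|by exists 0|].
  by rewrite subrr.
apply/asboolP; exists (P + Q'), (Q + P'); split; [exact: one_pointD..|].
rewrite /polytope_class !groth_classD opprB !opprD.
by rewrite [LHS](AC (2*2) ((1*3)*(2*4))).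
Qed.

HB.instance Definition _ := GRing.isZmodClosed.Build polytope_group
  singleton_differences singleton_differences_zmod.

(* the group [P_T(H)] *)
Definition polytope_groupT := Quotient.quot singleton_differences.
HB.instance Definition _ := GRing.Zmodule.on polytope_groupT.

Definition polytope_classT (x : polytope_group) : polytope_groupT := \pi x.

Definition is_singleton (T : polytope_groupT) : Prop :=
  exists2 P, one_point P & T = polytope_classT (polytope_class P).

Lemma is_singletonE T : is_singleton T <-> T = 0.
Proof.
split=> [[P hP ->]|->]; last first.
  exists 0; first by exists 0.
  rewrite /polytope_classT /polytope_class; apply/esym.
  by rewrite [groth_class 0](_ : _ = 0) ?raddf0 //; exact: groth_class0.
rewrite -[RHS](raddf0 \pi_polytope_groupT) /polytope_classT.
apply/eqP; rewrite -Quotient.idealrBE subr0; apply/asboolP.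
exists P, 0; split=> //; first by exists 0.
by rewrite [polytope_class 0]groth_class0 subr0.
Qed.

End PolytopeGroups.

Section Whitehead.
Variable G : groupType.

Definition K1_class n (A : 'M[group_ring G]_n) (hA : invertible_mx A) :
  K1 (group_ring G) := abel (GL_of hA).

Definition trivial_units : set (K1 (group_ring G)) :=
  [set x | exists (A : 'M[group_ring G]_1) (hA : invertible_mx A) (g : G),
    (A = (gring g)%:M \/ A = (- gring g)%:M) /\ x = K1_class hA].

Definition trivial_units_subgroup : normal_subgroup (K1 (group_ring G)) :=
  @abelian_subgroup (GL (group_ring G)) (generated trivial_units)
    (generated1 _) (@generatedM _ _) (@generatedV _ _).

Definition Wh := quotient_group trivial_units_subgroup.
HB.instance Definition _ := Group.on Wh.

Definition Wh_class n (A : 'M[group_ring G]_n) (hA : invertible_mx A) : Wh :=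
  quotient_proj trivial_units_subgroup (K1_class hA).

Lemma WhW (P : Wh -> Prop) :
  (forall n (A : 'M[group_ring G]_n) (hA : invertible_mx A), P (Wh_class hA)) ->
  forall w, P w.
Proof.
by move=> h; elim/quotient_groupW; elim/quotient_groupW; elim/GLW.
Qed.

End Whitehead.

Section UnitGroup.
Variable D : unitRingType.

Record unit_group := UnitGroup { unit_val :> D; _ : unit_val \is a GRing.unit }.
HB.instance Definition _ := [isSub for unit_val].
HB.instance Definition _ := [Choice of unit_group by <:].

Let ug_one : unit_group := UnitGroup (unitr1 D).

Let ug_mul_subproof (x y : unit_group) : (x : D) * (y : D) \is a GRing.unit.
Proof. by case: x y => [x hx] [y hy]; rewrite unitrMl. Qed.

Let ug_mul (x y : unit_group) : unit_group := UnitGroup (ug_mul_subproof x y).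

Let ug_inv_subproof (x : unit_group) : (x : D)^-1 \is a GRing.unit.
Proof. by case: x => x hx; rewrite unitrV. Qed.

Let ug_inv (x : unit_group) : unit_group := UnitGroup (ug_inv_subproof x).

Let ug_mulA : associative ug_mul.
Proof. by move=> x y z; apply: val_inj; rewrite /= mulrA. Qed.
Let ug_mul1 : left_id ug_one ug_mul.
Proof. by move=> x; apply: val_inj; rewrite /= mul1r. Qed.
Let ug_mul1r : right_id ug_one ug_mul.
Proof. by move=> x; apply: val_inj; rewrite /= mulr1. Qed.
Let ug_mulV : left_inverse ug_one ug_inv ug_mul.
Proof.
by move=> x; apply: val_inj; rewrite /= mulVr //; exact: (valP x).
Qed.
Let ug_mulVr : right_inverse ug_one ug_inv ug_mul.
Proof.
by move=> x; apply: val_inj; rewrite /= mulrV //; exact: (valP x).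
Qed.

HB.instance Definition _ := isGroup.Build unit_group
  ug_mulA ug_mul1 ug_mul1r ug_mulV ug_mulVr.

Lemma unit_valM : {morph unit_val : x y / (x * y)%g >-> x * y}.
Proof. by []. Qed.

(* clears the last column of [A] by row operations, for an invertible
   bottom-right entry *)
Definition schur_complement n (A : 'M[D]_n.+1) : 'M[D]_n :=
  \matrix_(i, j) (A (lift ord_max i) (lift ord_max j)
    - A (lift ord_max i) ord_max * (A ord_max ord_max)^-1
      * A ord_max (lift ord_max j)).

(* Canonical representative of the Dieudonne determinant. Swapping two
   columns changes the sign; the choice of the pivot column [j] is immaterial
   modulo commutators. *)
Fixpoint dieudonne_rep n : 'M[D]_n -> D :=
  match n with
  | 0%N => fun=> 1
  | n'.+1 => fun A =>
    if A ord_max ord_max != 0 then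
      dieudonne_rep (schur_complement A) * A ord_max ord_max
    else if [pick j | A ord_max j != 0] is Some j then
      let A' := xcol j ord_max A in
      - (dieudonne_rep (schur_complement A') * A' ord_max ord_max)
    else 0
  end.

(* valued in the abelianisation of [D^*], with [None] for the added 0 *)
Definition dieudonne_det n (A : 'M[D]_n) : option (abelianization unit_group) :=
  omap (@abel unit_group) (insub (dieudonne_rep A)).

End UnitGroup.

(* [c] identifies the free part [H] with Z^n, hence H (x) R with R^n. *)
Definition lattice_coordinates (G : groupType) n
    (c : free_part G -> 'rV[int]_n) : Prop :=
  bijective c /\ {morph c : h k / (h * k)%g >-> h + k}.

(* [G] is agrarian when such [K] and [j] exist. *)
Definition agrarian_embedding (G : groupType) (K : unitRingType)
    (j : {rmorphism group_ring G -> K}) : Prop :=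
  skew_field K /\ injective j.

(* This determines [D] over the Ore domain [T] up to a unique isomorphism: each
   [iota q], [q != 0], is invertible because [D] is a skew field. *)
Definition ore_localisation (T : nzRingType) (D : unitRingType)
    (iota : {rmorphism T -> D}) : Prop :=
  [/\ skew_field D, injective iota
    & forall d : D, exists p q, q != 0 /\ d = iota p / iota q].

Section Newton.
Variables (R : realType) (G : groupType) (K : unitRingType).
Variables (j : {rmorphism group_ring G -> K}) (s : free_part G -> G).
Variables (D : unitRingType) (iota : {rmorphism KH j s -> D}).
Variables (n : nat) (c : free_part G -> 'rV[int]_n).

Let support (p : KH j s) : seq 'rV[int]_n := [seq c h | h <- msupp p].

Let support_gt0 (p : KH j s) : p != 0 -> (0 < size (support p))%N.
Proof.
move=> p0; rewrite size_map lt0n; apply: contra p0 => /nilP supp0.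
by rewrite [p]monalgE supp0 big_nil.
Qed.

Definition newton_polytope (p : KH j s) (p0 : p != 0) : integral_polytope R n :=
  lattice_hull R (support_gt0 p0).

Lemma newton_polytopeE (p : KH j s) (p0 : p != 0) :
  polytope_set (newton_polytope p0) =
  convex_hull [set lattice_point R (c h) | h in [set h | h \in msupp p]].
Proof.
congr convex_hull; apply/seteqP; split=> x.
  by move=> /mapP[_ /mapP[h hp ->] ->]; exists h.
by move=> [h hp <-]; apply/mapP; exists (c h) => //; exact: map_f.
Qed.

(* The Newton polytope maps on D^*/[D^*,D^*] and on Wh(G) are given by their
   graphs: every choice of the fraction p q^-1, of its representative modulo
   commutators and of the matrix A is allowed. *)

(* [P = P(p) - P(q)] for [x] the class of [p q^-1] *)
Definition newton_abelianized (x : abelianization (unit_group D))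
    (P : polytope_group R n) : Prop :=
  exists (p q : KH j s) (p0 : p != 0) (q0 : q != 0) (u : unit_group D),
    [/\ abel u = x, unit_val u = iota p / iota q
      & P = polytope_class (newton_polytope p0)
            - polytope_class (newton_polytope q0)].

(* [T] is the class of [P(det(A (x) D))] for a matrix [A] representing [w] *)
Definition Whitehead_newton (w : Wh G) (T : polytope_groupT R n) : Prop :=
  exists m (A : 'M[group_ring G]_m) (hA : invertible_mx A)
    (x : abelianization (unit_group D)) (P : polytope_group R n),
    [/\ Wh_class hA = w,
        dieudonne_det (map_mx (fun a => iota (group_ring_to_KH j s a)) A) = Some x,
        newton_abelianized x P & T = polytope_classT P].

End Newton.

(* Main.v *)
Require Import Defs.
From HB Require Import structures.
From mathcomp Require Import all_boot all_order all_algebra perm finmap ssrAC ring lra zify.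
From mathcomp.multinomials Require Import monalg.
From mathcomp Require Import boolp classical_sets reals.

(** Write [H = Z^n] additively.  For integral functionals [chi], [delta] on [H], the
    face width of a nonzero [p] in [KH] is the length, measured by [delta], of the face
    of its Newton polytope on which [chi] is minimal.  It extends to a homomorphism from
    the units of [D] to [Z] by [p q^-1 |-> width p - width q].  The proof has two
    independent halves.

    Algebra: if [A] is invertible over [KH], every face width of [det A] vanishes
    ([unimodular_face_width]).  Let [K0] be the subfield of fractions of elements
    supported in the common kernel of [chi] and [delta].  For independent [chi] and
    [delta], completing [D] for the valuation given by [chi] yields a skew field of
    twisted Laurent series whose coefficients are fractions of twisted Laurent
    polynomials over [K0] in one variable [y].  The
    elements of [D] all of whose coefficients are honest Laurent polynomials in [y] form
    a ring [S] containing [KH].  The width of such an element is the width of its lowest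
    coefficient, hence is nonnegative; and dividing lowest coefficients in the Euclidean
    ring [K0[y, y^-1]] makes [S] Euclidean for the width ([closure_euclidean]): either
    the division ends with a remainder of smaller width, or it can be continued to
    arbitrary precision and the quotient lies in [S].  Column operations over [S] thus
    bring [A] to triangular form with units of [S] on the diagonal
    ([unimodular_has_det]), and a unit of [S] has width zero because it and its inverse
    have nonnegative widths.  That the given recipe for the Dieudonne determinant is
    compatible with column operations is proved directly for its image in [Z]
    ([has_det_col_op]).

    Geometry: two lattice polytopes with the same face widths are translates of each
    other.  The difference [f(chi)] of the minima of [chi] on the two polytopes is
    positively homogeneous and piecewise linear.  Along a suitably subdivided line
    [chi + k delta] its second difference at a subdivision point is minus the
    difference of the face widths there, hence zero; so [f] is additive
    ([min_difference_linear]), say [f(chi) = chi(x)].  Integral functionals approximate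
    real ones, so the support functions of the polytopes differ by [x]
    ([integral_hull_translate]).

    If [det A = p q^-1] up to commutators, the two halves give [P(p) = P(q) + x]. *)

Import Order.TTheory GRing.Theory Num.Theory.
Set Implicit Arguments.
Unset Strict Implicit.
Unset Printing Implicit Defensive.

(** * Determinants over a skew field, through a homomorphism to the integers *)

Section DieudonneDeterminant.
Local Open Scope ring_scope.
Variables (D : unitRingType) (mu : D -> int).
Hypothesis D_skew : skew_field D.
Hypothesis muM : forall x y : D, x != 0 -> y != 0 -> mu (x * y) = mu x + mu y.

Lemma skew_mul_neq0 (x y : D) : x != 0 -> y != 0 -> x * y != 0.
Proof.
move=> x0 y0; apply: contraNneq y0 => xy0.
by rewrite -[y](mulKr (D_skew x0)) xy0 mulr0.
Qed.

Lemma mu1 : mu 1 = 0.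
Proof.
apply: (@addrI _ (mu 1)); rewrite addr0 -muM ?oner_neq0 //.
by rewrite mulr1.
Qed.

Lemma muV x : x != 0 -> mu x^-1 = - mu x.
Proof.
move=> x0; apply: (@addrI _ (mu x)).
by rewrite subrr -muM ?invr_eq0 // mulrV ?D_skew // mu1.
Qed.

Lemma muN1 : mu (-1) = 0.
Proof.
have n0 : (-1 : D) != 0 by rewrite oppr_eq0 oner_neq0.
have := muM n0 n0; rewrite mulrNN mulr1 mu1 => /esym/eqP.
by rewrite -mulr2n mulrn_eq0 /= => /eqP.
Qed.

Lemma muN x : x != 0 -> mu (- x) = mu x.
Proof.
move=> x0; rewrite -mulN1r muM ?muN1 ?add0r //.
by rewrite oppr_eq0 oner_neq0.
Qed.

(** A predicate rather than a value, so that transporting it along column operations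
    transports invertibility too. *)
Definition has_det n (A : 'M[D]_n) (z : int) : Prop :=
  dieudonne_rep A != 0 /\ mu (dieudonne_rep A) = z.

(** The Schur complement at the last entry of column [j], the other columns being
    listed by [g].  Keeping [g] arbitrary lets one compare two pivots without fixing an
    order of the columns. *)
Definition pivot_minor n (j : 'I_n.+1) (g : 'I_n -> 'I_n.+1)
    (A : 'M[D]_n.+1) : 'M[D]_n :=
  \matrix_(i, l) (A (lift ord_max i) (g l)
    - A (lift ord_max i) j * (A ord_max j)^-1 * A ord_max (g l)).

(** Right multiplication by a matrix that differs from the identity in row [l0] only;
    the entry [x l0] scales column [l0], so that this covers both transvections and
    dilations and induces operations of the same kind on minors. *)
Definition col_op n (l0 : 'I_n) (x : 'I_n -> D) (A : 'M[D]_n) : 'M[D]_n :=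
  \matrix_(i, l) ((if l == l0 then 0 else A i l) + A i l0 * x l).

Lemma schur_xcol n (A : 'M[D]_n.+1) j :
  schur_complement (xcol j ord_max A) =
  pivot_minor j (tperm j ord_max \o lift ord_max) A.
Proof. by apply/matrixP => i l; rewrite !mxE tpermR. Qed.

Lemma has_det_mul n (A : 'M[D]_n.+1) (B : 'M[D]_n) a z : a != 0 ->
    dieudonne_rep A = dieudonne_rep B * a \/
    dieudonne_rep A = - (dieudonne_rep B * a) ->
  has_det A z <-> has_det B (z - mu a).
Proof.
move=> a0 AB; have aU := D_skew a0.
have mul0 (b : D) : (b * a != 0) = (b != 0).
  apply/idP/idP; first by apply: contraNneq => ->; rewrite mul0r.
  by move=> b0; exact: skew_mul_neq0.
rewrite /has_det; case: AB => ->; rewrite ?oppr_eq0 mul0.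
  split=> -[b0]; rewrite muM // => /eqP; first by rewrite eq_sym -subr_eq => /eqP <-.
  by rewrite eq_sym subr_eq => /eqP.
have [b0|b0] := eqVneq (dieudonne_rep B) 0; first by split=> -[].
rewrite muN ?skew_mul_neq0 // muM //.
split=> -[_]; first by move=> <-; rewrite addrK.
by move=> ->; rewrite subrK.
Qed.

Lemma dieudonne_pivot n (A : 'M[D]_n.+1) :
  ((forall k, A ord_max k = 0) /\ dieudonne_rep A = 0) \/
  exists k g, [/\ A ord_max k != 0, injective g, forall l, g l != k
    & forall z, has_det A z <-> has_det (pivot_minor k g A) (z - mu (A ord_max k))].
Proof.
have inj k : injective (tperm k ord_max \o lift ord_max : 'I_n -> 'I_n.+1).
  by move=> l l' /perm_inj/lift_inj.
have avoid k (l : 'I_n) : (tperm k ord_max \o lift ord_max) l != k.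
  rewrite /= -[X in _ != X](tpermR k ord_max) (inj_eq perm_inj).
  by rewrite eq_sym neq_lift.
have [a0|a0] := eqVneq (A ord_max ord_max) 0; last first.
  right; exists ord_max, (tperm ord_max ord_max \o lift ord_max); split=> // z.
  apply: has_det_mul => //; left; rewrite -schur_xcol /xcol tperm1 col_perm1 /=.
  by rewrite a0.
case E: [pick k | A ord_max k != 0] => [k|].
  have k0 : A ord_max k != 0 by move: E; case: pickP => // k' k'0 [<-].
  right; exists k, (tperm k ord_max \o lift ord_max); split=> // z.
  by apply: has_det_mul => //; right; rewrite -schur_xcol /= a0 eqxx E !mxE tpermR.
left; split=> [k|]; last by rewrite /= a0 eqxx E.
by apply/eqP; move: E; case: pickP => // /(_ k); case: eqP.
Qed.

Lemma avoid_onto n (j k : 'I_n.+1) (g : 'I_n -> 'I_n.+1) :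
  injective g -> (forall l, g l != j) -> k != j -> exists l, g l = k.
Proof.
move=> gi gj kj; suff /existsP[l /eqP] : [exists l, g l == k] by exists l.
apply: contraT; rewrite negb_exists => /forallP h.
pose G (o : option (option 'I_n)) :=
  if o is Some o' then if o' is Some m then g m else k else j.
have Gi : injective G.
  move=> [[a|]|] [[b|]|] //= e.
  - by rewrite (gi _ _ e).
  - by have := h a; rewrite e eqxx.
  - by have := gj a; rewrite e eqxx.
  - by have := h b; rewrite e eqxx.
  - by have := kj; rewrite e eqxx.
  - by have := gj b; rewrite e eqxx.
  - by have := kj; rewrite e eqxx.
by have := leq_card G Gi; rewrite !card_option !card_ord ltnn.
Qed.

Definition col_op_invariant n := forall (A : 'M[D]_n) l0 x z,
  x l0 != 0 -> has_det A z -> has_det (col_op l0 x A) (z + mu (x l0)).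

Section ColumnPermutation.
Variable n : nat.
Hypothesis C : col_op_invariant n.

(** Up to signs, which [mu] does not see, a transposition is a composite of column
    operations with scaling factors [1] and [-1]. *)
Lemma has_det_xcol (A : 'M[D]_n) j k z : has_det A z -> has_det (xcol j k A) z.
Proof.
have [->|jk] := eqVneq j k; first by rewrite /xcol tperm1 col_perm1.
pose x (a b : D) (l : 'I_n) := if l == j then a else if l == k then b else 0.
have kj : k == j = false by apply/negbTE; rewrite eq_sym.
have n1 : (-1 : D) != 0 by rewrite oppr_eq0 oner_neq0.
move=> /(C (l0 := j) (x := x 1 1)); rewrite /x eqxx mu1 addr0 => /(_ (oner_neq0 _)).
move=> /(C (l0 := k) (x := x (-1) 1)); rewrite /x kj eqxx mu1 addr0 => /(_ (oner_neq0 _)).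
move=> /(C (l0 := j) (x := x 1 1)); rewrite /x eqxx mu1 addr0 => /(_ (oner_neq0 _)).
move=> /(C (l0 := j) (x := x (-1) 0)); rewrite /x eqxx muN1 addr0 => /(_ n1).
congr has_det; apply/matrixP => i l; rewrite !mxE /= !eqxx kj (negbTE jk).
rewrite !mulr1 !mulrN1 !add0r.
case: (tpermP j k l) => [->|->|/eqP/negbTE e1 /eqP/negbTE e2]; last first.
  by rewrite e1 e2 !mulr0 !addr0.
- rewrite eqxx !kj mulr0 addr0 !mulr1 add0r.
  by rewrite addrC subrK.
- rewrite eqxx mulrN1 add0r opprB addrK.
  by [].
Qed.

Lemma has_det_col_perm (s : 'S_n) (A : 'M[D]_n) z :
  has_det A z -> has_det (col_perm s A) z.
Proof.
have [ts -> _] := prod_tpermP s; elim: ts A => [|t ts IH] A hA.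
  by rewrite big_nil col_perm1.
by rewrite big_cons col_permM; apply: has_det_xcol; apply: IH.
Qed.

Lemma has_det_pivot_minor (A : 'M[D]_n.+1) j g g' z :
    injective g -> injective g' ->
    (forall l, g l != j) -> (forall l, g' l != j) ->
  has_det (pivot_minor j g A) z -> has_det (pivot_minor j g' A) z.
Proof.
move=> gi g'i gj g'j.
have f l : exists l', g l' = g' l by apply: (avoid_onto gi gj).
have [s sE] : exists s : 'S_n, forall l, g (s l) = g' l.
  have [h hE] := boolp.choice f.
  have hi : injective h by move=> a b e; apply: g'i; rewrite -!hE e.
  by exists (perm hi) => l; rewrite permE.
move=> /(has_det_col_perm s); congr has_det.
by apply/matrixP => i l; rewrite !mxE sE.
Qed.

(** With [a] and [b] the entries at the old and the new pivot, the two minors differ by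
    a column operation with scaling factor [- b^-1 * a], which makes up for the change
    of pivot. *)
Lemma pivot_change (A : 'M[D]_n.+1) j k g z :
    A ord_max j != 0 -> A ord_max k != 0 -> injective g -> (forall l, g l != j) ->
    has_det (pivot_minor j g A) (z - mu (A ord_max j)) ->
  exists g', [/\ injective g', forall l, g' l != k
    & has_det (pivot_minor k g' A) (z - mu (A ord_max k))].
Proof.
move=> j0 k0 gi gj; have [<-|jk] := eqVneq j k; first by exists g.

have [l0 gl0] : exists l0, g l0 = k by apply: (avoid_onto gi gj); rewrite eq_sym.
pose a := A ord_max j; pose b := A ord_max k.
pose g' l := if l == l0 then j else g l.
pose x l := if l == l0 then - (b^-1 * a) else - (b^-1 * A ord_max (g l)).
have x0 : x l0 != 0.
  by rewrite /x eqxx oppr_eq0 skew_mul_neq0 ?invr_eq0.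
move=> /(C x0) h; exists g'; split.
- move=> l m; rewrite /g'; case: eqP => [->|_]; case: eqP => [->|_] //.
  + by move=> e; have := gj m; rewrite -e eqxx.
  + by move=> e; have := gj l; rewrite e eqxx.
  + exact: gi.
- move=> l; rewrite /g'; have [_|ll0] := eqVneq l l0 => //.
  by rewrite -gl0 (inj_eq gi).
have -> : z - mu b = z - mu a + mu (x l0).
  rewrite /x eqxx muN ?skew_mul_neq0 ?invr_eq0 // muM ?invr_eq0 //.
  by rewrite muV // [_ + mu a]addrC addrA subrK.
move: h; congr has_det; apply/matrixP => i l; rewrite !mxE /g' /x gl0 -/a -/b.
have aU : a \is a GRing.unit := D_skew j0.
have bU : b \is a GRing.unit := D_skew k0.
have [_|_] := eqVneq l l0.
  rewrite add0r mulrN -mulNr opprB mulrBl -!mulrA; congr (_ - _).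
  by rewrite (mulVKr bU) mulVr // mulr1.
rewrite -addrA; congr (_ + _); rewrite mulrN mulrBl opprB -!mulrA (mulVKr bU).
by rewrite addKr.
Qed.

Lemma has_det_pivot (A : 'M[D]_n.+1) j z : A ord_max j != 0 ->
  has_det A z <-> has_det (pivot_minor j (lift j) A) (z - mu (A ord_max j)).
Proof.
move=> j0; have [[all0 _]|[k [g [k0 gi gk h]]]] := dieudonne_pivot A.
  by rewrite all0 eqxx in j0.
have liftj (i : 'I_n.+1) l : lift i l != i by rewrite eq_sym neq_lift.
rewrite h; split=> [hk|hj].
  have [g' [g'i g'j]] := pivot_change k0 j0 gi gk hk.
  exact: (has_det_pivot_minor g'i (@lift_inj _ j)).
have [g' [g'i g'j]] := pivot_change j0 k0 (@lift_inj _ j) (liftj j) hj.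
exact: has_det_pivot_minor.
Qed.

End ColumnPermutation.

(** By induction on the size: with a well chosen pivot, which is legitimate by
    [has_det_pivot] in the previous size, a column operation either leaves the minor
    unchanged or induces a column operation on it. *)
Lemma has_det_col_op n : col_op_invariant n.
Proof.
elim: n => [|n C]; first by move=> A [].
move=> A l0 x z x0 hA; have xU := D_skew x0.
have [rl0|rl0] := eqVneq (A ord_max l0) 0; last first.
  (* The pivot is the column that is being added: the minor is unchanged. *)
  have r'l0 : col_op l0 x A ord_max l0 = A ord_max l0 * x l0.
    by rewrite mxE eqxx add0r.
  have r'0 : col_op l0 x A ord_max l0 != 0 by rewrite r'l0 skew_mul_neq0.
  apply/(has_det_pivot C _ r'0); rewrite r'l0 muM // opprD addrACA subrr addr0.
  move/(has_det_pivot C _ rl0): hA; congr has_det; apply/matrixP => i l.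
  have aU := D_skew rl0.
  rewrite !mxE eqxx !add0r [lift l0 l == _]eq_sym (negbTE (neq_lift _ _)) invrM //.
  rewrite !mulrA mulrK //.
  by rewrite mulrDr !mulrA mulrVK // opprD addrACA addrN addr0.
(* The added column vanishes in the last row: any other pivot survives. *)
have [k k0] : exists k, A ord_max k != 0.
  have [[_ rep0]|[k [g [k0 _ _ _]]]] := dieudonne_pivot A; last by exists k.
  by case: hA; rewrite rep0 eqxx.
have kl0 : l0 != k by apply: contraNneq k0 => <-; rewrite rl0.
have r' l : l != l0 -> col_op l0 x A ord_max l = A ord_max l.
  by move=> /negbTE ll0; rewrite mxE ll0 rl0 mul0r addr0.
have r'k : col_op l0 x A ord_max k = A ord_max k by rewrite r' // eq_sym.
have [m mE] : exists m, lift k m = l0.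
  by case: (unliftP k l0) => [m ->|e]; [exists m|rewrite e eqxx in kl0].
have r'0 : col_op l0 x A ord_max k != 0 by rewrite r'k.
apply/(has_det_pivot C _ r'0); rewrite r'k addrAC.
pose x' l := if l == m then x l0
  else x (lift k l) - x k * (A ord_max k)^-1 * A ord_max (lift k l).
have x'm : x' m = x l0 by rewrite /x' eqxx.
move/(has_det_pivot C _ k0)/(C _ m x'): hA; rewrite x'm => /(_ x0).
congr has_det; apply/matrixP => i l; rewrite !mxE /x' mE rl0.
rewrite [k == l0]eq_sym (negbTE kl0) !mul0r !addr0 -mE (inj_eq lift_inj).
have [->|_] := eqVneq l m; first by rewrite !add0r !mulr0 !subr0.
by rewrite !mulr0 !subr0 mulrBr !mulrDl opprD addrACA !mulrA.
Qed.

(** A subring on which [mu] is a Euclidean norm; division is on the left, to match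
    operations on columns. *)
Section Euclidean.
Variable S : D -> Prop.
Hypothesis S0 : S 0.
Hypothesis SB : forall x y, S x -> S y -> S (x - y).
Hypothesis SM : forall x y, S x -> S y -> S (x * y).
Hypothesis mu_ge0 : forall x, S x -> x != 0 -> 0 <= mu x.
Hypothesis euclid : forall a b, S a -> S b -> b != 0 ->
  exists q, S q /\ (a - b * q = 0 \/ mu (a - b * q) < mu b).

Definition entries_in m n (A : 'M[D]_(m, n)) := forall i j, S (A i j).

Let SD x y : S x -> S y -> S (x + y).
Proof. by move=> Sx Sy; rewrite -[y]opprK -[- y]sub0r; apply: SB (SB _ _). Qed.

Let S_sum (I : Type) (r : seq I) (P : pred I) (F : I -> D) :
  (forall i, S (F i)) -> S (\sum_(i <- r | P i) F i).
Proof. by move=> SF; apply: big_ind. Qed.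

Lemma entries_in_mul m n p (A : 'M[D]_(m, n)) (B : 'M[D]_(n, p)) :
  entries_in A -> entries_in B -> entries_in (A *m B).
Proof. by move=> SA SBB i j; rewrite mxE; apply: S_sum => k; exact: SM. Qed.

(** The operation is multiplication by [1 + E] with [E * E = 0], so [1 - E] corrects the
    right inverse without leaving the subring. *)
Lemma transvection_unimodular n (A B : 'M[D]_n) j (y : 'I_n -> D) :
    y j = 0 -> (forall l, S (y l)) -> entries_in A -> entries_in B ->
    A *m B = 1%:M ->
  let A' := col_op j (fun l => if l == j then 1 else y l) A in
  entries_in A' /\ exists2 B', entries_in B' & A' *m B' = 1%:M.
Proof.
move=> yj Sy SA SBB AB A'.
pose E : 'M[D]_n := \matrix_(i, l) if i == j then y l else 0.
have SE : entries_in E by move=> i l; rewrite mxE; case: eqP.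
have AE : A' = A + A *m E.
  apply/matrixP => i l; rewrite !mxE (bigD1 j) //= big1 ?addr0.
    rewrite mxE eqxx; have [->|_] := eqVneq l j; last by [].
    by rewrite yj mulr0 addr0 add0r mulr1.
  by move=> k /negbTE kj; rewrite mxE kj mulr0.
have EE : E *m E = 0.
  apply/matrixP => i l; rewrite !mxE big1 // => k _; rewrite !mxE.
  by have [->|_] := eqVneq k j; rewrite ?yj ?mulr0 //; case: eqP => _; rewrite mul0r.
split; first by move=> i l; rewrite AE mxE; apply: SD => //; exact: entries_in_mul.
exists (B - E *m B).
  have SEB := entries_in_mul SE SBB.
  by move=> i l; rewrite 2!mxE; exact: SB.
rewrite AE mulmxDl !mulmxBr AB -!mulmxA [E *m (E *m B)]mulmxA EE mul0mx mulmx0 subr0.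
by rewrite subrK.
Qed.

(** Among the column-equivalent matrices take one with a last-row entry of least norm:
    it divides the other entries of that row, which can then be cleared.  The right
    inverse shows that this pivot is a unit of the subring, hence of norm zero, and it
    restricts to a right inverse of the minor. *)
Lemma unimodular_has_det n (A B : 'M[D]_n) :
  entries_in A -> entries_in B -> A *m B = 1%:M -> has_det A 0.
Proof.
elim: n A B => [|n IH] A B SA SBB AB; first by split; [exact: oner_neq0|exact: mu1].
have [j j0] : exists j, A ord_max j != 0.
  suff /existsP[j j0] : [exists j, A ord_max j != 0] by exists j.
  apply: contraT; rewrite negb_exists => /forallP h.
  have /matrixP/(_ ord_max ord_max) := AB; rewrite !mxE eqxx big1 => [/eqP|k _].
    by rewrite eq_sym oner_eq0.
  by have /eqP-> := negbNE (h k); rewrite mul0r.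
have [w] := ubnP `|mu (A ord_max j)|%N.
elim: w => // w IHw in A B SA SBB AB j j0 *; rewrite ltnS => wA.
have Col := has_det_col_op.
have Ay y : y j = 0 -> has_det (col_op j (fun l => if l == j then 1 else y l) A) 0 ->
    has_det A 0.
  move=> yj /(Col _ _ j (fun l => if l == j then 1 else - y l)).
  rewrite eqxx mu1 => /(_ (oner_neq0 _)); congr has_det; apply/matrixP => i l.
  rewrite !mxE; have [->|_] := eqVneq l j; rewrite ?eqxx.
    by rewrite !add0r !mulr1.
  by rewrite add0r mulr1 mulrN addrK.
have [q qP] := boolp.choice (fun l => euclid (SA ord_max l) (SA ord_max j) j0).
pose y l := if l == j then 0 else - q l.
have yj : y j = 0 by rewrite /y eqxx.
have Sy l : S (y l).
  by rewrite /y; case: eqP => // _; rewrite -sub0r; apply: SB => //; case: (qP l).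
have [] := transvection_unimodular yj Sy SA SBB AB.
set A' := col_op _ _ _ => SA' [B' SB' AB'].
have A'j : A' ord_max j = A ord_max j by rewrite mxE eqxx add0r mulr1.
have A'l l : l != j -> A' ord_max l = A ord_max l - A ord_max j * q l.
  by move=> /negbTE lj; rewrite mxE /y lj mulrN.
(* From now on [A'] replaces [A]; its last row consists of the remainders. *)
apply: (Ay y yj); rewrite -/A' {Ay}; clearbody A'.
case: (boolP [exists l, (l != j) && (A' ord_max l != 0)]) => [/existsP[l /andP[lj l0]]|].
  apply: (IHw _ _ SA' SB' AB' _ l0); apply: leq_trans wA.
  have := mu_ge0 (SA' _ _) l0; have := mu_ge0 (SA _ _) j0.
  have [_ [e|]] := qP l; first by rewrite A'l // e eqxx in l0.
  by rewrite -A'l // => lt /gez0_abs ej /gez0_abs el; rewrite -ltz_nat ej el.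
rewrite negb_exists => /forallP h.
have A'0 l : l != j -> A' ord_max l = 0.
  by move=> lj; have := h l; rewrite lj /= negbK => /eqP.
have A'j0 : A' ord_max j != 0 by rewrite A'j.
have A'B' i k : A' i j * B' j k + \sum_l A' i (lift j l) * B' (lift j l) k = (i == k)%:R.
  by have /matrixP/(_ i k) := AB'; rewrite !mxE (bigD1_ord j).
have last_row k : A' ord_max j * B' j k = (ord_max == k)%:R.
  rewrite -A'B' big1 ?addr0 // => l _; rewrite A'0 ?mul0r //.
  by rewrite eq_sym neq_lift.
have jU := D_skew A'j0.
have B'j l : B' j (lift ord_max l) = 0.
  rewrite -[LHS](mulKr jU) last_row (negbTE (neq_lift _ _)) mulr0.
  by [].
have B'jV : B' j ord_max = (A' ord_max j)^-1.
  by rewrite -[LHS](mulKr jU) last_row eqxx mulr1.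
apply/(has_det_pivot (Col _) _ A'j0).
have -> : mu (A' ord_max j) = 0.
  apply/eqP; rewrite eq_le mu_ge0 // andbT -oppr_ge0 -muV // -B'jV mu_ge0 //.
  by rewrite B'jV invr_eq0.
rewrite subr0.
apply: (IH _ (\matrix_(l, i) B' (lift j l) (lift ord_max i))).
- move=> i l; rewrite mxE [A' ord_max (lift j l)]A'0 ?mulr0 ?subr0 //.
  by rewrite eq_sym neq_lift.
- by move=> i l; rewrite mxE.
apply/matrixP => i k; have := A'B' (lift ord_max i) (lift ord_max k).
rewrite B'j mulr0 add0r (inj_eq lift_inj) !mxE => <-; apply: eq_bigr => l _.
rewrite !mxE [A' ord_max (lift j l)]A'0 ?mulr0 ?subr0 //.
by rewrite eq_sym neq_lift.
Qed.

End Euclidean.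

End DieudonneDeterminant.

(** * Valuations on the Ore localisation of a twisted group ring *)

Section Cones.
Local Open Scope ring_scope.
Variable V : zmodType.

(** The nonnegative elements of a translation-invariant total order, [z] preceding [w]
    when [C (w - z)]. *)
Record positive_cone (C : pred V) : Prop := PositiveCone {
  cone_total : forall z, C z || C (- z);
  cone_add : forall z w, C z -> C w -> C (z + w);
  cone_anti : forall z, C z -> C (- z) -> z = 0 }.

Lemma cone0 C : positive_cone C -> C 0.
Proof. by case=> /(_ 0); rewrite oppr0 orbb. Qed.

Lemma cone_least C (F : seq V) : positive_cone C -> (0 < size F)%N ->
  exists2 z, z \in F & forall w, w \in F -> C (w - z).
Proof.
move=> hC; elim: F => // z [|z' F] IH _.
  by exists z; rewrite ?mem_head // => w; rewrite inE => /eqP->; rewrite subrr cone0.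
have [y yF ymin] := IH isT.
case/orP: (cone_total hC (z - y)) => zy.
  exists y => [|w]; first by rewrite inE yF orbT.
  by rewrite inE => /orP[/eqP->//|/ymin].
exists z => [|w]; first exact: mem_head.
rewrite inE => /orP[/eqP->|/ymin wy]; first by rewrite subrr cone0.
by rewrite -[w - z](subrKA y); apply: (cone_add hC) => //; rewrite -opprB.
Qed.

End Cones.

Section Valuation.
Local Open Scope ring_scope.
Variables (B : unitRingType) (H : groupType) (u : H -> B).
Hypothesis u_unit : forall h, u h \is a GRing.unit.
Hypothesis B_skew : skew_field B.
Notation TH := (twisted_ring u_unit).
Variables (V : zmodType) (c : H -> V).
Hypothesis c_inj : injective c.
Hypothesis cM : {morph c : h k / (h * k)%g >-> h + k}.
Variables (D : unitRingType) (iota : {rmorphism TH -> D}).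
Hypothesis D_ore : ore_localisation iota.

Let D_skew : skew_field D. Proof. by case: D_ore. Qed.

Let iota_neq0 p : (iota p != 0) = (p != 0).
Proof.
case: D_ore => _ inj _; apply/idP/idP; first by apply: contraNneq => ->; rewrite rmorph0.
by apply: contraNneq => e; apply/eqP/inj; rewrite e rmorph0.
Qed.

Let iota_unit p : p != 0 -> iota p \is a GRing.unit.
Proof. by rewrite -iota_neq0 => /D_skew. Qed.

Let TH_neq0 (p q : TH) : p != 0 -> q != 0 -> p * q != 0.
Proof. by rewrite -!iota_neq0 rmorphM; exact: skew_mul_neq0. Qed.

Lemma ore (q p : TH) : q != 0 -> exists r s : TH, s != 0 /\ q * r = p * s.
Proof.
move=> q0; case: D_ore => _ inj /(_ ((iota q)^-1 * iota p))[r [s [s0 e]]].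
exists r, s; split=> //; apply: inj.
rewrite !rmorphM -[iota r](mulrVK (iota_unit s0)) -e.
by rewrite !mulrA mulrV ?iota_unit // mul1r.
Qed.

Lemma ore_cancel (p q r : TH) : q != 0 -> r != 0 ->
  iota (p * r) / iota (q * r) = iota p / iota q.
Proof.
move=> q0 r0; rewrite !rmorphM invrM ?iota_unit // mulrA; congr (_ * _).
by rewrite mulrK ?iota_unit.
Qed.

Lemma ore_mul (p q p' q' r s : TH) : q != 0 -> q' != 0 -> s != 0 ->
    q * r = p' * s ->
  iota p / iota q * (iota p' / iota q') = iota (p * r) / iota (q' * s).
Proof.
move=> q0 q0' s0 qr; rewrite -(ore_cancel p' q0' s0) -qr !rmorphM !mulrA.
by rewrite mulrVK ?iota_unit.
Qed.

Lemma ore_add (p q p' q' r s : TH) : q != 0 -> q' != 0 -> r != 0 -> s != 0 ->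
    q * r = q' * s ->
  iota p / iota q + iota p' / iota q' = iota (p * r + p' * s) / iota (q * r).
Proof.
move=> q0 q0' r0 s0 qr; rewrite -(ore_cancel p q0 r0) -(ore_cancel p' q0' s0) -qr.
by rewrite rmorphD mulrDl.
Qed.

Lemma ore_neq0 (p q r s : TH) : p != 0 -> s != 0 -> q * r = p * s -> r != 0.
Proof.
move=> p0 s0 e; apply: contraTneq (TH_neq0 p0 s0) => r0.
by rewrite -e r0 mulr0 eqxx.
Qed.

Lemma twisted_mulE (p q : TH) : p * q = \sum_(h <- msupp p) \sum_(k <- msupp q)
  << p@_h * tw_action u h q@_k * tw_cocycle u h k *g (h * k)%g >>.
Proof. by []. Qed.

Lemma mcoeff_sum (I : Type) (r : seq I) (P : pred I) (F : I -> TH) g :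
  mcoeff g (\sum_(i <- r | P i) F i) = \sum_(i <- r | P i) mcoeff g (F i).
Proof. exact: raddf_sum. Qed.

Lemma twisted_mul_coeff (p q : TH) g : mcoeff g (p * q) =
  \sum_(h <- msupp p) \sum_(k <- msupp q)
     (p@_h * tw_action u h q@_k * tw_cocycle u h k) *+ ((h * k)%g == g).
Proof.
rewrite twisted_mulE mcoeff_sum; apply: eq_bigr => h _.
by rewrite mcoeff_sum; apply: eq_bigr => k _; rewrite mcoeffU.
Qed.

Lemma twisted_mul_supp (p q : TH) g : g \in msupp (p * q) ->
  exists h k, [/\ h \in msupp p, k \in msupp q & g = (h * k)%g].
Proof.
rewrite -mcoeff_neq0 twisted_mul_coeff => g0; apply: contrapT => no.
case/negP: g0; apply/eqP; apply: big1_seq => h /= hp; apply: big1_seq => k /= kq.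
by case: eqP => // gE; case: no; exists h, k.
Qed.

Section Lowest.
Variable C : pred V.
Hypothesis hC : positive_cone C.

Definition lowest (p : TH) z :=
  (exists2 h, h \in msupp p & c h = z) /\ forall h, h \in msupp p -> C (c h - z).

Lemma lowest_ex p : p != 0 -> exists z, lowest p z.
Proof.
move=> p0; have [|z /mapP[h hp zE] zmin] :=
    @cone_least _ C [seq c h | h <- msupp p] hC.
  rewrite size_map lt0n; apply: contra p0 => /nilP supp0.
  by rewrite [p]monalgE supp0 big_nil.
exists z; split; first by exists h.
by move=> k kp; apply: zmin; exact: map_f.
Qed.

Lemma lowest_neq0 p z : lowest p z -> p != 0.
Proof. by case=> -[h hp _] _; apply: contraTneq hp => ->; rewrite msupp0. Qed.

Lemma lowest_uniq p z z' : lowest p z -> lowest p z' -> z = z'.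
Proof.
move=> [[h hp <-] hmin] [[k kp <-] kmin]; apply/eqP; rewrite -subr_eq0; apply/eqP.
apply: (cone_anti hC); first exact: kmin.
by rewrite opprB; exact: hmin.
Qed.

(** The product of the lowest terms is the only contribution to its degree, because the
    order is total and translation-invariant; its coefficient is a product of units. *)
Lemma lowest_mul p q z w : lowest p z -> lowest q w -> lowest (p * q) (z + w).
Proof.
move=> [[h0 hp <-] hmin] [[k0 kq <-] kmin]; split; last first.
  move=> _ /twisted_mul_supp[h [k [{}hp {}kq ->]]].
  by rewrite cM opprD addrACA; apply: (cone_add hC); [exact: hmin|exact: kmin].
exists (h0 * k0)%g; last exact: cM.
rewrite -mcoeff_neq0 twisted_mul_coeff (bigD1_seq h0) ?fset_uniq //=.
rewrite (bigD1_seq k0) ?fset_uniq //= eqxx mulr1n.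
have zero h k : h \in msupp p -> k \in msupp q -> (h * k)%g = (h0 * k0)%g ->
    h = h0 /\ k = k0.
  move=> {}hp {}kq hk; have := congr1 c hk; rewrite !cM => e.
  have {}e : c h - c h0 = - (c k - c k0).
    by apply/eqP; rewrite -addr_eq0 addrACA -opprD e subrr.
  have h0E : h = h0.
    apply/c_inj/eqP; rewrite -subr_eq0; apply/eqP/(cone_anti hC); first exact: hmin.
    by rewrite e opprK; exact: kmin.
  by split=> //; move: hk; rewrite h0E => /mulgI.
rewrite [X in _ + X + _]big1_seq => [|k /andP[kk0 {}kq]]; last first.
  by case: eqP => // /(zero _ _ hp kq)[_ kE]; rewrite kE eqxx in kk0.
rewrite [X in _ + X]big1_seq => [|h /andP[hh0 {}hp]]; last first.
  apply: big1_seq => k /andP[_ {}kq].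
  by case: eqP => // /(zero _ _ hp kq)[hE _]; rewrite hE eqxx in hh0.
have uV h : (u h)^-1 != 0.
  by rewrite invr_eq0; apply: contraTneq (u_unit h) => ->; rewrite unitr0.
have u0 h : u h != 0 by rewrite -invr_eq0 uV.
rewrite !addr0 /tw_action /tw_cocycle.
by do ![apply: (skew_mul_neq0 B_skew)] => //; rewrite mcoeff_neq0.
Qed.

Lemma lowest_add p q z w y : lowest p z -> lowest q w -> lowest (p + q) y ->
  C (y - z) \/ C (y - w).
Proof.
move=> [_ zmin] [_ wmin] [[h hpq <-] _].
have /(fsubsetP (msuppD_le _ _)) := hpq.
by rewrite inE => /orP[/zmin|/wmin]; [left|right].
Qed.

(** A fraction has many presentations; [valuationE] shows that all of them give the same
    degree, so that picking one is harmless.  None exists for [x = 0]. *)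
Definition valuation_graph (x : D) (z : V) := exists p q a b,
  [/\ lowest p a, lowest q b, x = iota p / iota q & z = a - b].

Definition valuation (x : D) : V := xget 0 (valuation_graph x).

Lemma valuationE p q a b : lowest p a -> lowest q b -> valuation (iota p / iota q) = a - b.
Proof.
move=> pa qb; set x := iota p / iota q.
have : valuation_graph x (valuation x) by apply: (@xgetI _ 0 _ (a - b)); exists p, q, a, b.
move: (valuation x) => z [p' [q' [a' [b' [pa' qb' e ->]]]]].
have [p0 q0] := (lowest_neq0 pa, lowest_neq0 qb).
have [p0' q0'] := (lowest_neq0 pa', lowest_neq0 qb').
have [r [s [s0 qr]]] := ore q' q0.
have r0 := ore_neq0 q0' s0 qr.
have pr : p * r = p' * s.
  case: D_ore => _ inj _; apply: inj; rewrite !rmorphM.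
  rewrite -[iota p](mulrVK (iota_unit q0)) -/x e -[_ * iota q * _]mulrA -[iota q * iota r]rmorphM qr rmorphM.
  by rewrite mulrA mulrVK ?iota_unit.
have [d rd] := lowest_ex r0; have [f sf] := lowest_ex s0.
have adE : a + d = a' + f.
  by apply: (lowest_uniq (lowest_mul pa rd)); rewrite pr; exact: lowest_mul.
have bdE : b + d = b' + f.
  by apply: (lowest_uniq (lowest_mul qb rd)); rewrite qr; exact: lowest_mul.
apply: (@addIr _ (b + d)); rewrite {1}bdE !addrA !subrK.
by [].
Qed.

Lemma valuation_fraction x : x != 0 -> exists p q a b,
  [/\ lowest p a, lowest q b, x = iota p / iota q & valuation x = a - b].
Proof.
move=> x0; case: D_ore => _ _ /(_ x)[p [q [q0 xE]]].
have p0 : p != 0 by apply: contraNneq x0 => p0; rewrite xE p0 rmorph0 mul0r.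
have [a pa] := lowest_ex p0; have [b qb] := lowest_ex q0.
by exists p, q, a, b; split=> //; rewrite xE; exact: valuationE.
Qed.

Lemma valuation_mul x y : x != 0 -> y != 0 -> valuation (x * y) = valuation x + valuation y.
Proof.
move=> /valuation_fraction[p [q [a [b [pa qb -> ->]]]]] /valuation_fraction[p' [q' [a' [b' [pa' qb' -> ->]]]]].
have [p0 q0] := (lowest_neq0 pa, lowest_neq0 qb).
have [p0' q0'] := (lowest_neq0 pa', lowest_neq0 qb').
have [r [s [s0 qr]]] := ore p' q0.
have [d rd] := lowest_ex (ore_neq0 p0' s0 qr); have [f sf] := lowest_ex s0.
rewrite (ore_mul _ q0 q0' s0 qr) (valuationE (lowest_mul pa rd) (lowest_mul qb' sf)).
have e : b + d = a' + f.
  by apply: (lowest_uniq (lowest_mul qb rd)); rewrite qr; exact: lowest_mul.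
have -> : d = a' + f - b by rewrite -e addrAC subrr add0r.
by rewrite opprD !addrA [LHS](AC (6) ((1*4)*2*5*(3*6))) /= subrr addr0.
Qed.

Lemma valuation_add x y : x != 0 -> y != 0 -> x + y != 0 ->
  C (valuation (x + y) - valuation x) \/ C (valuation (x + y) - valuation y).
Proof.
move=> /valuation_fraction[p [q [a [b [pa qb -> ->]]]]] /valuation_fraction[p' [q' [a' [b' [pa' qb' -> ->]]]]].
have [p0 q0] := (lowest_neq0 pa, lowest_neq0 qb).
have [p0' q0'] := (lowest_neq0 pa', lowest_neq0 qb').
have [r [s [s0 qr]]] := ore q' q0.
have r0 := ore_neq0 q0' s0 qr.
have [d rd] := lowest_ex r0; have [f sf] := lowest_ex s0.
rewrite (ore_add _ _ q0 q0' r0 s0 qr) => xy0.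
have n0 : p * r + p' * s != 0.
  by apply: contraNneq xy0 => ->; rewrite rmorph0 mul0r.
have [m nm] := lowest_ex n0; rewrite (valuationE nm (lowest_mul qb rd)).
have e : b + d = b' + f.
  by apply: (lowest_uniq (lowest_mul qb rd)); rewrite qr; exact: lowest_mul.
have h (g k l : V) : m - (k + l) - (g - k) = m - (g + l).
  by rewrite opprB !opprD !addrA [LHS](AC 5 (1*5*3*(2*4))) /= addNr addr0.
have [hC1|hC1] := lowest_add (lowest_mul pa rd) (lowest_mul pa' sf) nm.
  by left; rewrite h.
by right; rewrite e h.
Qed.

End Lowest.
Section Graded.
Variables (W : zmodType) (gr : H -> W).
Hypothesis grM : {morph gr : h k / (h * k)%g >-> h + k}.

Definition homogeneous (w : W) (p : TH) := forall h, h \in msupp p -> gr h = w.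

Definition component (w : W) (p : TH) : TH :=
  \sum_(h <- msupp p | gr h == w) << p@_h *g h >>.

Lemma component_coeff w p g :
  mcoeff g (component w p) = if gr g == w then mcoeff g p else 0.
Proof.
rewrite mcoeff_sum; have [gp|gp] := boolP (g \in msupp p); last first.
  rewrite [mcoeff g p]mcoeff_outdom // if_same; apply: big1_seq => h /andP[_ hp].
  by rewrite mcoeffU; case: eqP => // hg; rewrite -hg hp in gp.
case: ifP => gw.
  rewrite big_mkcond (bigD1_seq g) ?fset_uniq //= gw mcoeffUU big1 ?addr0 // => h hg.
  by rewrite mcoeffU (negbTE hg) mulr0n if_same.
apply: big1_seq => h /andP[hw _]; rewrite mcoeffU.
by case: eqP => // hg; rewrite -hg hw in gw.
Qed.

Lemma homogeneous_component w p : homogeneous w (component w p).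
Proof.
by move=> h; rewrite -mcoeff_neq0 component_coeff; case: (gr h =P w) => // _; rewrite eqxx.
Qed.

Lemma component_mul w w' (p q : TH) : homogeneous w p ->
  component (w + w') (p * q) = p * component w' q.
Proof.
move=> hp; apply/malgP => g; rewrite component_coeff.
have incl : (msupp (component w' q) `<=` msupp q)%fset.
  apply/fsubsetP => k; rewrite -!mcoeff_neq0 component_coeff.
  by case: ifP => // _; rewrite eqxx.
rewrite !twisted_mul_coeff (fun_if (fun x => x)).
have -> : (if gr g == w + w' then \sum_(h <- msupp p) \sum_(k <- msupp q)
     (p@_h * tw_action u h q@_k * tw_cocycle u h k) *+ ((h * k)%g == g) else 0) =
  \sum_(h <- msupp p) \sum_(k <- msupp q) if gr g == w + w' then
     (p@_h * tw_action u h q@_k * tw_cocycle u h k) *+ ((h * k)%g == g) else 0.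
  case: ifP => // _; rewrite big1 // => h _; exact: big1.
apply: eq_big_seq => h {}/hp hw; rewrite [RHS](big_fset_incl _ incl) /=.
  apply: eq_bigr => k _; rewrite component_coeff.
  case: ((h * k)%g =P g) => [<-|_]; last by rewrite !mulr0n if_same.
  rewrite grM hw (inj_eq (addrI w)) !mulr1n; case: ifP => // _.
  by rewrite /tw_action !(mulr0, mul0r).
move=> k _ /mcoeff_outdom kq; rewrite [mcoeff k _]kq.
by rewrite /tw_action !(mulr0, mul0r) mul0rn.
Qed.

Lemma homogeneous0 w : homogeneous w 0.
Proof. by move=> h; rewrite msupp0. Qed.

Lemma homogeneousN w p : homogeneous w p -> homogeneous w (- p).
Proof. by move=> hp h; rewrite msuppN; exact: hp. Qed.

Lemma homogeneousD w p q : homogeneous w p -> homogeneous w q ->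
  homogeneous w (p + q).
Proof.
move=> hp hq h /(fsubsetP (msuppD_le _ _)); rewrite inE.
by case/orP; [exact: hp|exact: hq].
Qed.

Lemma homogeneousM w w' p q : homogeneous w p -> homogeneous w' q ->
  homogeneous (w + w') (p * q).
Proof.
by move=> hp hq _ /twisted_mul_supp[h [k [/hp <- /hq <- ->]]]; rewrite grM.
Qed.

(** Any common multiple of homogeneous elements has homogeneous components that are
    again common multiples. *)
Lemma homogeneous_ore w w' q p : q != 0 -> homogeneous w q -> homogeneous w' p ->
  exists r s v v', [/\ s != 0, homogeneous v r, homogeneous v' s, q * r = p * s
    & w + v = w' + v'].
Proof.
move=> q0 hq hp; have [r [s [s0 qr]]] := ore p q0.
have [h hs] : exists h, h \in msupp s.
  case: (fset_0Vmem (msupp s)) => [e|[h hs]]; last by exists h.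
  by case/eqP: s0; rewrite [s]monalgE e big_seq_fset0.
exists (component (w' + gr h - w) r), (component (gr h) s), (w' + gr h - w), (gr h).
split; [|exact: homogeneous_component|exact: homogeneous_component| |].
- apply: contraTneq hs => e; rewrite -mcoeff_neq0 negbK.
  have := component_coeff (gr h) s h; rewrite e mcoeff0 eqxx => <-.
  exact: eqxx.
- by rewrite -(component_mul _ _ hq) -(component_mul _ _ hp) -qr addrC subrK.
- by rewrite addrC subrK.
Qed.

(** The degree [w] part of the homogeneous localisation of the twisted group ring.  The
    numerator may vanish, so that this is an additive subgroup. *)
Definition graded (w : W) (x : D) := exists p q w1 w2,
  [/\ q != 0, homogeneous w1 p, homogeneous w2 q, w = w1 - w2 & x = iota p / iota q].

Lemma homogeneous1 : homogeneous 0 1.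
Proof.
move=> h /(fsubsetP msuppU_le); rewrite inE => /eqP ->.
by apply: (@addrI _ (gr 1%g)); rewrite -grM mulg1 addr0.
Qed.

Lemma homogeneous_graded w p : homogeneous w p -> graded w (iota p).
Proof.
move=> hp; exists p, 1, w, 0; split=> //; rewrite ?oner_eq0 ?subr0 //.
  exact: homogeneous1.
by rewrite rmorph1 divr1.
Qed.

Lemma graded0 w : graded w 0.
Proof. by rewrite -(rmorph0 iota); exact/homogeneous_graded/homogeneous0. Qed.

Lemma gradedN w x : graded w x -> graded w (- x).
Proof.
move=> [p [q [w1 [w2 [q0 hp hq -> ->]]]]]; exists (- p), q, w1, w2.
by split=> //; [exact: homogeneousN|rewrite rmorphN mulNr].
Qed.

Lemma gradedD w x y : graded w x -> graded w y -> graded w (x + y).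
Proof.
move=> [p [q [w1 [w2 [q0 hp hq -> ->]]]]] [p' [q' [w1' [w2' [q0' hp' hq' e ->]]]]].
have [r [s [v [v' [s0 hr hs qr vE]]]]] := homogeneous_ore q0 hq hq'.
have r0 := ore_neq0 q0' s0 qr.
exists (p * r + p' * s), (q * r), (w1 + v), (w2 + v); split.
- exact: TH_neq0.
- apply: homogeneousD; first exact: homogeneousM.
  suff -> : w1 + v = w1' + v' by exact: homogeneousM.
  have -> : w1' = w1 - w2 + w2' by rewrite e subrK.
  by rewrite -addrA -vE addrA subrK.
- exact: homogeneousM.
- by rewrite opprD addrACA subrr addr0.
- exact: ore_add.
Qed.

Lemma gradedM w w' x y : graded w x -> graded w' y -> graded (w + w') (x * y).
Proof.
move=> [p [q [w1 [w2 [q0 hp hq -> ->]]]]] [p' [q' [w1' [w2' [q0' hp' hq' -> ->]]]]].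
have [r [s [v [v' [s0 hr hs qr vE]]]]] := homogeneous_ore q0 hq hp'.
exists (p * r), (q' * s), (w1 + v), (w2' + v'); split.
- exact: TH_neq0.
- exact: homogeneousM.
- exact: homogeneousM.
- have -> : w1' = w2 + v - v' by rewrite vE addrK.
  by rewrite opprD !addrA [LHS](AC 6 (1*4*6*5*(2*3))) /= addNr addr0 addrAC.
- exact: ore_mul.
Qed.

Lemma gradedV w x : x != 0 -> graded w x -> graded (- w) x^-1.
Proof.
move=> x0 [p [q [w1 [w2 [q0 hp hq -> xE]]]]].
have p0 : p != 0 by apply: contraNneq x0 => p0; rewrite xE p0 rmorph0 mul0r.
exists q, p, w2, w1; split; rewrite ?opprB // xE invrM ?unitrV ?iota_unit //.
by rewrite invrK.
Qed.

Lemma graded_valuation (C : pred V) (g : V -> W) w x : positive_cone C ->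
    {morph g : a b / a - b} -> (forall h, gr h = g (c h)) ->
  x != 0 -> graded w x -> g (valuation C x) = w.
Proof.
move=> hC gB grE x0 [p [q [w1 [w2 [q0 hp hq -> xE]]]]].
have p0 : p != 0 by apply: contraNneq x0 => p0; rewrite xE p0 rmorph0 mul0r.
have [a pa] := lowest_ex hC p0; have [b qb] := lowest_ex hC q0.
rewrite xE (valuationE hC pa qb) gB.
have [[[h hh <-] _] [[k kk <-] _]] := (pa, qb).
by rewrite -!grE (hp _ hh) (hq _ kk).
Qed.

End Graded.

End Valuation.

(** * A Euclidean ring between the group ring and its skew field *)

Section LexValuations.
Local Open Scope ring_scope.
Variable D : unitRingType.

Definition lexle (a b a' b' : int) := (a < a') || (a == a') && (b <= b').

(** A rank two valuation, split into its dominant component [X] and its second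
    component [E]. *)
Record lex_valuation (X E : D -> int) : Prop := LexValuation {
  lex_mulX : forall x y, x != 0 -> y != 0 -> X (x * y) = X x + X y;
  lex_mulE : forall x y, x != 0 -> y != 0 -> E (x * y) = E x + E y;
  lex_add : forall x y, x != 0 -> y != 0 -> x + y != 0 ->
    lexle (X x) (E x) (X (x + y)) (E (x + y)) \/
    lexle (X y) (E y) (X (x + y)) (E (x + y)) }.

Section Above.
Variables (X E : D -> int).
Hypothesis v : lex_valuation X E.

Definition above N m (x : D) := x = 0 \/ lexle N m (X x) (E x).

Lemma lexle_trans a b a' b' a'' b'' :
  lexle a b a' b' -> lexle a' b' a'' b'' -> lexle a b a'' b''.
Proof. rewrite /lexle; lia. Qed.

Lemma lexle_succr a b a' b' : lexle a b a' b' -> lexle a b a' (b' + 1).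
Proof. rewrite /lexle; lia. Qed.

Lemma lexle_succl a b a' b' : lexle a (b + 1) a' b' -> lexle a b a' b'.
Proof. rewrite /lexle; lia. Qed.

Lemma above_le N m N' m' x : lexle N m N' m' -> above N' m' x -> above N m x.
Proof. by move=> le [->|h]; [left|right; exact: lexle_trans h]. Qed.

Lemma above_self x : above (X x) (E x) x.
Proof. by right; rewrite /lexle eqxx lexx orbT. Qed.

Lemma aboveD N m x y : above N m x -> above N m y -> above N m (x + y).
Proof.
have [->|x0] := eqVneq x 0; first by rewrite add0r.
have [->|y0] := eqVneq y 0; first by rewrite addr0.
move=> [/eqP|hx]; first by rewrite (negbTE x0).
move=> [/eqP|hy]; first by rewrite (negbTE y0).
have [->|xy0] := eqVneq (x + y) 0; first by left.
by right; case: (lex_add v x0 y0 xy0); exact: lexle_trans.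
Qed.

Lemma aboveN N m x : above N m x -> above N m (- x).
Proof.
have [->|x0] := eqVneq x 0; first by rewrite oppr0.
move=> [->|h]; first by rewrite oppr0; left.
by right; rewrite (muN (lex_mulX v)) // (muN (lex_mulE v)).
Qed.

Lemma aboveB N m x y : above N m x -> above N m y -> above N m (x - y).
Proof. by move=> hx hy; apply: aboveD => //; exact: aboveN. Qed.

Lemma aboveM N m N' m' x y : above N m x -> above N' m' y ->
  above (N + N') (m + m') (x * y).
Proof.
have [->|x0] := eqVneq x 0; first by rewrite mul0r; left.
have [->|y0] := eqVneq y 0; first by rewrite mulr0; left.
move=> [/eqP|hx]; first by rewrite (negbTE x0).
move=> [/eqP|hy]; first by rewrite (negbTE y0).
right; rewrite (lex_mulX v) // (lex_mulE v) //; move: hx hy; rewrite /lexle; lia.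
Qed.

(** Otherwise [l], a combination of [x] and [x - l], would itself be of strictly higher
    degree. *)
Lemma same_lead l x : l != 0 -> above (X l) (E l + 1) (x - l) ->
  [/\ x != 0, X x = X l & E x = E l].
Proof.
move=> l0 h; have strict : ~ above (X l) (E l + 1) l.
  by move=> [/eqP|]; [rewrite (negbTE l0)|rewrite /lexle; lia].
have x0 : x != 0.
  apply/eqP => x0; apply: strict.
  by have := aboveN h; rewrite x0 sub0r opprK.
have : above (X l) (E l) x.
  rewrite -(subrK l x); apply: aboveD; last exact: above_self.
  by apply: above_le h; rewrite /lexle; lia.
have : ~ above (X l) (E l + 1) x.
  by move=> hx; apply: strict; have := aboveB hx h; rewrite subKr.
move=> no [/eqP|yes]; first by rewrite (negbTE x0).
have {}no : ~ lexle (X l) (E l + 1) (X x) (E x) by move=> h'; apply: no; right.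
move: no yes; rewrite /lexle => no yes; split=> //; lia.
Qed.

End Above.

Definition aboveX (X : D -> int) N (x : D) := x = 0 \/ N <= X x.

Lemma lead_of_approx X E x y l : lex_valuation X E -> x != 0 -> l != 0 ->
    aboveX X (X x + 1) (x - y) -> above X E (X l) (E l + 1) (y - l) ->
  [/\ X x = X l, E x = E l & above X E (X l) (E l + 1) (x - l)].
Proof.
move=> v x0 l0 xy yl; have [y0 yX yE] := same_lead v l0 yl.
have h : above X E (X x) (E x + 1) (x - y).
  by case: xy => [->|le]; [left|right; rewrite /lexle; lia].
have [_ yxX yxE] : [/\ y != 0, X y = X x & E y = E x].
  by apply: (same_lead v x0); rewrite -opprB; exact: aboveN.
have xX : X x = X l by rewrite -yxX.
have xE : E x = E l by rewrite -yxE.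
by split=> //; rewrite -(subrKA y); apply: (aboveD v) => //; rewrite -xX -xE.
Qed.

End LexValuations.

(** [P] and [M] are the lowest and the highest second degree among the terms whose
    first degree is the least one, [X]; both refine the same coarse valuation [X]. *)
Section EuclideanClosure.
Local Open Scope ring_scope.
Variable D : unitRingType.
Hypothesis D_skew : skew_field D.
Variables X P M : D -> int.
Hypothesis vP : lex_valuation X P.
Hypothesis vM : lex_valuation X (fun x => - M x).
Variable graded : int * int -> D -> Prop.
Hypothesis graded0 : forall w, graded w 0.
Hypothesis gradedN : forall w x, graded w x -> graded w (- x).
Hypothesis gradedD : forall w x y, graded w x -> graded w y -> graded w (x + y).
Hypothesis gradedM : forall w w' x y, graded w x -> graded w' y ->
  graded (w + w') (x * y).
Hypothesis gradedV : forall w x, x != 0 -> graded w x -> graded (- w) x^-1.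
Hypothesis graded_val : forall w x, x != 0 -> graded w x ->
  [/\ X x = w.1, P x = w.2 & M x = w.2].

Definition width (x : D) : int := M x - P x.

(** A ring of twisted Laurent polynomials in at most two variables, with coefficients in
    the skew field of elements of degree zero. *)
Inductive graded_span : D -> Prop :=
| graded_span0 : graded_span 0
| graded_spanD w x y : graded w x -> graded_span y -> graded_span (x + y).

Lemma graded_in_span w x : graded w x -> graded_span x.
Proof. by move=> hx; rewrite -[x]addr0; apply: graded_spanD hx graded_span0. Qed.

Lemma span_add x y : graded_span x -> graded_span y -> graded_span (x + y).
Proof.
by elim=> [|w z z' hz _ IH] hy; rewrite ?add0r // -addrA; apply: graded_spanD hz (IH hy).
Qed.

Lemma span_opp x : graded_span x -> graded_span (- x).
Proof.
elim=> [|w y z hy _ IH]; first by rewrite oppr0; exact: graded_span0.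
by rewrite opprD; apply: graded_spanD IH; exact: gradedN hy.
Qed.

Lemma span_mul x y : graded_span x -> graded_span y -> graded_span (x * y).
Proof.
elim=> [|w a b ha _ IH] hy; first by rewrite mul0r; exact: graded_span0.
rewrite mulrDl; apply: span_add (IH hy).
elim: hy => [|w' a' b' ha' _ IH']; first by rewrite mulr0; exact: graded_span0.
by rewrite mulrDr; apply: graded_spanD IH'; exact: gradedM ha ha'.
Qed.

(** Terms of equal degree are collected, so that no cancellation between distinct terms
    can affect the leading degree. *)
Lemma span_normal x : graded_span x -> exists (e : seq (int * int)) f,
  [/\ uniq e, forall w, graded w (f w) & x = \sum_(w <- e) f w].
Proof.
elim=> [|w a y ha _ [e [f [ue hf ->]]]].
  by exists [::], (fun=> 0); rewrite big_nil.
have [we|we] := boolP (w \in e).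
  exists e, (fun w' => if w' == w then a + f w else f w'); split=> // [w'|].
    by case: eqP => // ->; exact: gradedD.
  rewrite !(bigD1_seq w) //= eqxx addrA; congr (_ + _).
  by apply: eq_bigr => w' /negbTE ->.
exists (w :: e), (fun w' => if w' == w then a else f w'); split=> [|w'|].
- by rewrite /= we.
- by case: eqP => // ->.
rewrite big_cons eqxx; congr (_ + _); apply: eq_big_seq => w' w'e.
by case: eqP => // w'w; rewrite -w'w w'e in we.
Qed.

Section Leading.
Variables (E : D -> int) (s : int).
Hypothesis v : lex_valuation X E.
Hypothesis s0 : s != 0.
Hypothesis Es : forall w x, x != 0 -> graded w x -> E x = s * w.2.

(** Treats the two refinements of [X] at once: [s = 1] finds the lowest and [s = -1] the
    highest term in the [X]-lowest layer. *)
Lemma leading_term (e : seq (int * int)) f : uniq e -> (forall w, graded w (f w)) ->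
  (forall w, w \in e -> f w = 0) \/
  exists w0, [/\ w0 \in e, f w0 != 0,
    above X E (X (f w0)) (E (f w0) + 1) (\sum_(w <- e) f w - f w0)
    & forall w, w \in e -> f w != 0 -> lexle w0.1 (s * w0.2) w.1 (s * w.2)].
Proof.
move=> ue hf; have gv w : f w != 0 -> X (f w) = w.1 /\ E (f w) = s * w.2.
  by move=> fw; rewrite (Es fw (hf w)); case: (graded_val fw (hf w)).
elim: e ue => [|w e IH] /=; first by left.
move=> /andP[we /IH]; rewrite big_cons.
have [fw|fw] := eqVneq (f w) 0; rewrite ?fw ?add0r.
  case=> [all0|[w0 [w0e fw0 lead wmin]]].
    by left=> w'; rewrite inE => /orP[/eqP->|/all0].
  right; exists w0; split=> //; first by rewrite inE w0e orbT.
  by move=> w'; rewrite inE => /orP[/eqP->|/wmin//]; rewrite fw eqxx.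
have [Xw Ew] := gv w fw.
case=> [all0|[w0 [w0e fw0 lead wmin]]]; right.
  exists w; split=> //; first exact: mem_head.
    by rewrite big1_seq ?addr0 ?subrr; [left|move=> w' /= /all0].
  move=> w'; rewrite inE => /orP[/eqP-> _|/all0 ->]; last by rewrite eqxx.
  by rewrite /lexle eqxx lexx orbT.
have [X0 E0] := gv w0 fw0; rewrite X0 E0 in lead.
have ne : ~ (w.1 = w0.1 /\ s * w.2 = s * w0.2).
  case=> e1 /(mulfI s0) e2; case/negP: we.
  by rewrite (_ : w = w0) //; case: w w0 e1 e2 {fw fw0 Xw Ew X0 E0 w0e lead wmin} => [a b] [a' b'] /= -> ->.
have Dw : above X E w.1 (s * w.2) (f w).
  by rewrite -Xw -Ew; exact: above_self.
have D0 : above X E w0.1 (s * w0.2) (f w0).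
  by rewrite -X0 -E0; exact: above_self.
have [lt|lt] : lexle w.1 (s * w.2 + 1) w0.1 (s * w0.2) \/
    lexle w0.1 (s * w0.2 + 1) w.1 (s * w.2) by rewrite /lexle; lia.
  exists w; rewrite Xw Ew; split=> //; first exact: mem_head.
    rewrite addrAC subrr add0r -(subrK (f w0) (\sum_(_ <- e) _)).
    apply: (aboveD v); last exact: above_le D0.
    exact: above_le (lexle_succr lt) lead.
  move=> w'; rewrite inE => /orP[/eqP-> _|h1 /(wmin _ h1)].
    by rewrite /lexle eqxx lexx orbT.
  exact: lexle_trans (lexle_succl lt).
exists w0; rewrite X0 E0; split=> //; first by rewrite inE w0e orbT.
  by rewrite -addrA; apply: (aboveD v) => //; exact: above_le Dw.
move=> w'; rewrite inE => /orP[/eqP-> _|/wmin//].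
exact: lexle_succl lt.
Qed.

End Leading.

(** The closure in the [X]-adic topology.  It plays the role of the Laurent series with
    Laurent polynomial coefficients that happen to lie in [D]. *)
Definition span_closure (x : D) := forall N, exists2 y, graded_span y & aboveX X N (x - y).

(** A sufficiently precise finite sum has the same leading terms at both ends of the
    lowest layer. *)
Lemma closure_leading x : span_closure x -> x != 0 -> exists w l,
  [/\ graded w l, l != 0, X x = w.1 /\ P x = w.2,
   above X P w.1 (w.2 + 1) (x - l) & w.2 <= M x].
Proof.
move=> /(_ (X x + 1))[y /span_normal[e [f [ue hf yE]]] xy] x0.
have y0 : ~ forall w, w \in e -> f w = 0.
  move=> all0; case: xy; rewrite yE big1_seq; try by move=> w /= /all0.
    by rewrite subr0 => /eqP; rewrite (negbTE x0).
  by rewrite subr0; lia.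
have EP w z : z != 0 -> graded w z -> P z = 1 * w.2.
  by move=> z0 hz; rewrite mul1r; case: (graded_val z0 hz).
have EM w z : z != 0 -> graded w z -> - M z = -1 * w.2.
  by move=> z0 hz; rewrite mulN1r; case: (graded_val z0 hz) => _ _ ->.
have [//|[w [we fw lead wmin]]] := leading_term vP (oner_neq0 _) EP ue hf.
have [//|[w' [we' fw' lead' wmin']]] := leading_term vM (isT : (-1 : int) != 0) EM ue hf.
rewrite -yE in lead lead'.
have [Xx Px above_l] := lead_of_approx vP x0 fw xy lead.
have [Xx' Mx _] := lead_of_approx vM x0 fw' xy lead'.
have [Xw Pw _] := graded_val fw (hf w); have [Xw' _ Mw'] := graded_val fw' (hf w').
exists w, (f w); split; rewrite -?Pw -?Xw //.
move: Mx => /= /oppr_inj ->; have := wmin _ we' fw'.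
rewrite !mul1r -Xw -Pw -Xw' -Mw' -Xx -Xx' /lexle ltxx eqxx.
by [].
Qed.

Lemma width_ge0 x : span_closure x -> x != 0 -> 0 <= width x.
Proof. by move=> hx /(closure_leading hx)[w [l [_ _ [_ Px] _ le]]]; rewrite subr_ge0 Px. Qed.

Let vX : lex_valuation X (fun=> 0).
Proof.
split=> [x y x0 y0|x y _ _|x y x0 y0 xy0]; [exact: lex_mulX vP _ _ x0 y0|by []|].
by case: (lex_add vP x0 y0 xy0); rewrite /lexle; [left|right]; lia.
Qed.

Let aboveXE N x : aboveX X N x <-> above X (fun=> 0) N 0 x.
Proof. by split=> -[->|h]; [left|right|left|right] => //; move: h; rewrite /lexle; lia. Qed.

Let aboveX_add N x y : aboveX X N x -> aboveX X N y -> aboveX X N (x + y).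
Proof. by rewrite !aboveXE; exact: (aboveD vX). Qed.

Let aboveX_opp N x : aboveX X N x -> aboveX X N (- x).
Proof. by rewrite !aboveXE; exact: (aboveN vX). Qed.

Let aboveX_mul N N' x y : aboveX X N x -> aboveX X N' y -> aboveX X (N + N') (x * y).
Proof. by rewrite !aboveXE => hx /(aboveM vX hx); rewrite addr0. Qed.

Lemma span_in_closure x : graded_span x -> span_closure x.
Proof. by move=> hx N; exists x => //; left; rewrite subrr. Qed.

Lemma closureB x y : span_closure x -> span_closure y -> span_closure (x - y).
Proof.
move=> hx hy N; have [x' sx xx'] := hx N; have [y' sy yy'] := hy N.
exists (x' - y'); first by apply: span_add => //; exact: span_opp.
have -> : x - y - (x' - y') = (x - x') - (y - y').
  by rewrite !opprB [LHS](AC (2*2) ((1*4)*(3*2))).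
by apply: aboveX_add => //; exact: aboveX_opp.
Qed.

Lemma closureM x y : span_closure x -> span_closure y -> span_closure (x * y).
Proof.
move=> hx hy N; have [x' sx xx'] := hx (N - X y).
have [y' sy yy'] := hy (N - X x').
exists (x' * y'); first exact: span_mul.
have -> : x * y - x' * y' = (x - x') * y + x' * (y - y').
  by rewrite mulrBl mulrBr addrA subrK.
have self z : aboveX X (X z) z by right.
apply: aboveX_add.
  by rewrite -(subrK (X y) N); exact: aboveX_mul.
by rewrite -(subrK (X x') N) addrC; exact: aboveX_mul.
Qed.

(** Cancelling the lower ends of the two lowest layers, by the quotient of the leading
    terms, shortens the layer of [a] from below, or removes it; as [b] is not
    wider than [a], it is not lengthened from above. *)
Lemma division_step a b : span_closure a -> span_closure b -> a != 0 -> b != 0 ->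
    width b <= width a -> exists2 m, graded_span m &
  [\/ a - b * m = 0, X a < X (a - b * m)
    | X (a - b * m) = X a /\ width (a - b * m) < width a].
Proof.
move=> ha hb a0 b0 ba.
have [w [l [gl l0 [Xa Pa] lead _]]] := closure_leading ha a0.
have [w' [l' [gl' l0' [Xb Pb] lead' _]]] := closure_leading hb b0.
have gm : graded (- w' + w) (l'^-1 * l) by apply: gradedM => //; exact: gradedV.
have m0 : l'^-1 * l != 0 by rewrite skew_mul_neq0 ?invr_eq0.
exists (l'^-1 * l); first exact: graded_in_span gm.
have [Xm Pm Mm] := graded_val m0 gm.
set m := l'^-1 * l in gm m0 Xm Pm Mm *.
have hP : above X P (X a) (P a + 1) (a - b * m).
  have -> : a - b * m = (a - l) - (b - l') * m.
    by rewrite mulrBl opprB /m mulVKr ?D_skew // subrKA.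
  apply: (aboveB vP); first by rewrite Xa Pa.
  have := aboveM vP lead' (above_self X P m); rewrite Xm Pm Xa Pa /=.
  by congr above; lia.
have hM : above X (fun x => - M x) (X a) (- M a) (a - b * m).
  apply: (aboveB vM); first exact: (above_self X (fun x => - M x)).
  apply: above_le (aboveM vM (above_self X _ b) (above_self X _ m)).
  rewrite Xm Mm /= -Xa -Pa -Xb -Pb; move: ba; rewrite /width /lexle; lia.
case: hP => [->|hP]; first by constructor 1.
case: hM => [->|hM]; first by constructor 1.
move: hP hM; rewrite /lexle; case: (ltgtP (X a)) => //= [lt _ _|-> hP hM].
  by constructor 2.
by constructor 3; split=> //; move: hP hM; rewrite /width; lia.
Qed.

(** Iterates [division_step]; the width cannot decrease forever. *)
Lemma division_or_deeper a b : span_closure a -> span_closure b -> a != 0 -> b != 0 ->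
  exists2 q, graded_span q &
  [\/ a - b * q = 0, width (a - b * q) < width b | X a < X (a - b * q)].
Proof.
move=> ha hb a0 b0; have [k] := ubnP `|width a|%N.
elim: k a ha a0 => // k IH a ha a0; rewrite ltnS => ak.
have [lt|ge] := ltP (width a) (width b).
  exists 0; first exact: graded_span0.
  by rewrite mulr0 subr0; constructor 2.
have [m sm h] := division_step ha hb a0 b0 ge.
have [z|nz] := eqVneq (a - b * m) 0; first by exists m => //; constructor 1.
case: h => [z|lt|[Xa' wa']]; [by rewrite z eqxx in nz|by exists m => //; constructor 3|].
have ha' : span_closure (a - b * m).
  by apply: closureB => //; apply: closureM => //; exact: span_in_closure.
have [] := IH _ ha' nz.
  by have := width_ge0 ha' nz; have := width_ge0 ha a0; lia.
move=> q sq; rewrite Xa' => h; exists (m + q); first exact: span_add.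
by rewrite mulrDr opprD addrA.
Qed.

Lemma division_approx a b N : span_closure a -> span_closure b -> b != 0 ->
  exists2 q, graded_span q &
    width (a - b * q) < width b \/ aboveX X N (a - b * q).
Proof.
move=> ha hb b0; have [k] := ubnP `|N - X a|%N.
elim: k a ha => // k IH a ha; rewrite ltnS => ak.
have stop : aboveX X N a -> exists2 q, graded_span q &
    width (a - b * q) < width b \/ aboveX X N (a - b * q).
  by move=> h; exists 0; [exact: graded_span0|rewrite mulr0 subr0; right].
have [a0|a0] := eqVneq a 0; first by apply: stop; left.
have [le|lt] := leP N (X a); first by apply: stop; right.
have [q sq [z|w|deep]] := division_or_deeper ha hb a0 b0.
- by exists q => //; rewrite z; right; left.
- by exists q => //; left.
have ha' : span_closure (a - b * q).
  by apply: closureB => //; apply: closureM => //; exact: span_in_closure.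
have [Nle|ltN] := leP N (X (a - b * q)); first by exists q => //; right; right.
have [|q' sq' h] := IH _ ha'; first by lia.
exists (q + q'); first exact: span_add.
by rewrite mulrDr opprD addrA.
Qed.

(** If no finite stage of the division has a remainder of smaller width, the partial
    quotients converge to [b^-1 * a], which is therefore in the ring. *)
Lemma closure_euclidean a b : span_closure a -> span_closure b -> b != 0 ->
  exists q, span_closure q /\ (a - b * q = 0 \/ width (a - b * q) < width b).
Proof.
move=> ha hb b0.
have [[q sq lt]|no] := pselect (exists2 q, graded_span q & width (a - b * q) < width b).
  by exists q; split; [exact: span_in_closure|right].
exists (b^-1 * a); split; last by left; rewrite mulVKr ?subrr ?D_skew.
move=> N; have [q sq [lt|h]] := division_approx (N + X b) ha hb b0.
  by case: no; exists q.
exists q => //; have -> : b^-1 * a - q = b^-1 * (a - b * q).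
  by rewrite mulrBr mulKr ?D_skew.
have -> : N = X b^-1 + (N + X b).
  by rewrite (muV D_skew (lex_mulX vP)) // addrC addrK.
by apply: aboveX_mul h; right.
Qed.

Lemma unimodular_width0 n (A B : 'M[D]_n) :
  entries_in span_closure A -> entries_in span_closure B -> A *m B = 1%:M ->
  dieudonne_rep A != 0 /\ width (dieudonne_rep A) = 0.
Proof.
have widthM x y : x != 0 -> y != 0 -> width (x * y) = width x + width y.
  move=> x0 y0; have := lex_mulE vM x0 y0; have := lex_mulE vP x0 y0.
  by rewrite /width => ->; lia.
move=> hA hB AB; apply: (unimodular_has_det D_skew widthM _ closureB closureM _ _ hA hB AB).
- exact/span_in_closure/graded_span0.
- exact: width_ge0.
- exact: closure_euclidean.
Qed.

End EuclideanClosure.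

(** * Minima of integral functionals on finite sets of lattice points *)

Section LexicographicCones.
Local Open Scope ring_scope.
Variable V : zmodType.

Fixpoint lex_nonneg (s : seq int) : bool :=
  if s is a :: s' then (0 < a) || (a == 0) && lex_nonneg s' else true.

Definition lex_cone (fs : seq (V -> int)) : pred V :=
  fun z => lex_nonneg [seq f z | f <- fs].

Lemma lex_cone_positive (fs : seq (V -> int)) :
    (forall f, List.In f fs -> zmod_morphism f) ->
    (forall z, (forall f, List.In f fs -> f z = 0) -> z = 0) ->
  positive_cone (lex_cone fs).
Proof.
move=> fB inj; have f0 f : List.In f fs -> f 0 = 0.
  by move=> /fB h; have := h 0 0; rewrite !subrr.
have fN f z : List.In f fs -> f (- z) = - f z.
  by move=> hf; have := fB f hf 0 z; rewrite !sub0r (f0 f hf) sub0r.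
have fD f z w : List.In f fs -> f (z + w) = f z + f w.
  by move=> hf; rewrite -[w in LHS]opprK fB // fN // opprK.
split.
- move=> z; rewrite /lex_cone; elim: fs fN {inj f0 fD fB} => //= f fs IH fN.
  have := IH (fun f z h => fN f z (or_intror h)).
  by rewrite (fN f z (or_introl erefl)); lia.
- move=> z w; rewrite /lex_cone; elim: fs fD {inj f0 fN fB} => //= f fs IH fD.
  have := IH (fun f z w h => fD f z w (or_intror h)).
  by rewrite (fD f z w (or_introl erefl)); lia.
move=> z hz hNz; apply: inj; move: hz hNz; rewrite /lex_cone.
elim: fs fN {f0 fD fB} => //= f fs IH fN.
have := IH (fun f z h => fN f z (or_intror h)).
rewrite (fN f z (or_introl erefl)) => IH' h1 h2 g [<-|]; first by lia.
by apply: IH'; lia.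
Qed.

End LexicographicCones.

Section IntegralFunctionals.
Local Open Scope ring_scope.
Variable n : nat.
Local Notation V := 'rV[int]_n.
Implicit Types (chi delta phi psi z w : V) (F : seq V).

Definition idot chi z : int := \sum_i chi 0 i * z 0 i.

Lemma idotDl chi psi z : idot (chi + psi) z = idot chi z + idot psi z.
Proof. by rewrite /idot -big_split; apply: eq_bigr => i _; rewrite mxE mulrDl. Qed.

Lemma idotZl (k : int) chi z : idot (k *: chi) z = k * idot chi z.
Proof. by rewrite /idot mulr_sumr; apply: eq_bigr => i _; rewrite mxE mulrA. Qed.

Lemma idotNl chi z : idot (- chi) z = - idot chi z.
Proof. by rewrite -scaleN1r idotZl mulN1r. Qed.

Lemma idotDr chi z w : idot chi (z + w) = idot chi z + idot chi w.
Proof. by rewrite /idot -big_split; apply: eq_bigr => i _; rewrite mxE mulrDr. Qed.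

Lemma idotNr chi z : idot chi (- z) = - idot chi z.
Proof. by rewrite /idot -sumrN; apply: eq_bigr => i _; rewrite mxE mulrN. Qed.

Lemma idotBr chi : zmod_morphism (idot chi).
Proof. by move=> z w; rewrite idotDr idotNr. Qed.

(** The coordinates are appended only to make the order total. *)
Definition flag_cone chi delta : pred V :=
  lex_cone [:: idot chi, idot delta & [seq (fun z : V => z 0 i) | i <- enum 'I_n]].

Lemma flag_cone_positive chi delta : positive_cone (flag_cone chi delta).
Proof.
apply: lex_cone_positive => [f|z h].
  case=> [<-|[<-|]]; [exact: idotBr|exact: idotBr|].
  by move=> /(List.in_map_iff _ _ _).1 [i [<- _]] z w; rewrite !mxE.
apply/rowP => i; rewrite mxE; apply: (h (fun z : V => z 0 i)); right; right.
apply/(List.in_map_iff _ _ _).2; exists i; split=> //.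
have : i \in enum 'I_n by rewrite mem_enum.
elim: (enum 'I_n) => //= j e IH; rewrite inE => /orP[/eqP->|/IH]; first by left.
by right.
Qed.

Lemma flag_cone_lexle chi delta z w : flag_cone chi delta (w - z) ->
  lexle (idot chi z) (idot delta z) (idot chi w) (idot delta w).
Proof. rewrite /flag_cone /lex_cone /= !idotBr /lexle; lia. Qed.

Definition lex_min F chi delta z :=
  z \in F /\ forall w, w \in F -> lexle (idot chi z) (idot delta z) (idot chi w) (idot delta w).

(** The points [z], [z'] are the two ends, with respect to [delta], of the face where
    [chi] is minimal. *)
Definition same_face_widths F1 F2 := forall chi delta, exists z z' y y',
  [/\ lex_min F1 chi delta z /\ lex_min F1 chi (- delta) z',
      lex_min F2 chi delta y /\ lex_min F2 chi (- delta) y'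
    & idot delta (z' - z) = idot delta (y' - y)].

Definition is_min F chi a :=
  (exists2 z, z \in F & idot chi z = a) /\ forall z, z \in F -> a <= idot chi z.

Lemma is_min_uniq F chi a b : is_min F chi a -> is_min F chi b -> a = b.
Proof.
move=> [[z zF <-] zmin] [[w wF <-] wmin].
by apply/eqP; rewrite eq_le zmin ?wmin.
Qed.

Lemma is_min_ex F chi : (0 < size F)%N -> exists a, is_min F chi a.
Proof.
move=> F0; have [z zF zmin] := cone_least (flag_cone_positive chi 0) F0.
exists (idot chi z); split=> [|w /zmin/flag_cone_lexle]; first by exists z.
by rewrite /lexle; lia.
Qed.

Lemma is_minZ F chi a (k : int) : 0 <= k -> is_min F chi a -> is_min F (k *: chi) (k * a).
Proof.
move=> k0 [[z zF <-] zmin]; split=> [|w wF]; first by exists z; rewrite ?idotZl.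
by rewrite idotZl ler_wpM2l // zmin.
Qed.

Lemma lex_min_min F chi delta z : lex_min F chi delta z -> is_min F chi (idot chi z).
Proof.
move=> [zF zmin]; split=> [|w /zmin]; first by exists z.
by rewrite /lexle; lia.
Qed.

(** A difference on which [chi] is positive takes there a value of [chi] that is at least
    the absolute value of [delta]: moving from [chi] to [chi + delta] or [chi - delta]
    may create ties but reverses no inequality. *)
Definition adapted F chi delta := forall z w, z \in F -> w \in F ->
  exists m : int, idot delta (w - z) != 0 -> idot chi (w - z) = m * idot delta (w - z).

(** Points off the face of [chi] cannot fall below its lower end, because no strict
    inequality is reversed on the way from [chi] to [chi + delta]. *)
Lemma lex_min_shift F chi delta z : adapted F chi delta ->
  lex_min F chi delta z -> is_min F (chi + delta) (idot chi z + idot delta z).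
Proof.
move=> ad [zF zmin]; split=> [|w wF]; first by exists z; rewrite ?idotDl.
have [m] := ad z w zF wF; have := zmin w wF; rewrite idotDl !idotBr /lexle.
move: (idot delta w) (idot delta z) (idot chi w) (idot chi z) => a b c d.
have [ab|ab] := leP 0 (a - b); first by move=> h _; lia.
move=> h e; have {}e : c - d = m * (a - b) by apply: e; rewrite lt_eqF.
have m0 : m < 0 by rewrite ltNge; apply/negP => m0; have := mulr_ge0_le0 m0 (ltW ab); lia.
have := mulr_le0 (_ : m + 1 <= 0) (ltW ab); rewrite mulrDl mul1r; lia.
Qed.

Lemma common_multiple (s : seq int) : exists N : nat,
  (0 < N)%N /\ forall d, d \in s -> d != 0 -> (d %| N%:Z)%Z.
Proof.
elim: s => [|d s [N [N0 IH]]]; first by exists 1%N.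
have [->|d0] := eqVneq d 0.
  by exists N; split=> // d'; rewrite inE => /orP[/eqP->|/IH//]; rewrite eqxx.
exists (N * `|d|)%N; split=> [|d']; first by rewrite muln_gt0 N0 absz_gt0.
rewrite PoszM inE => /orP[/eqP-> _|/IH h /h]; last exact: dvdz_mulr.
by apply: dvdz_mull; rewrite dvdzE /= dvdnn.
Qed.

Lemma arithmetic_progression (g : nat -> int) :
    (forall k, g k.+2 + g k = g k.+1 *+ 2) ->
  forall k, g k = g 0%N + k%:Z * (g 1%N - g 0%N).
Proof.
move=> h k; suff [] : g k = g 0%N + k%:Z * (g 1%N - g 0%N) /\
    g k.+1 = g 0%N + k.+1%:Z * (g 1%N - g 0%N) by [].
elim: k => [|k [IH1 IH2]]; first by split; rewrite ?mul0r ?addr0 // mul1r addrC subrK.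
split=> //; apply: (@addIr _ (g k)); rewrite h [in LHS]IH2 IH1.
by rewrite -[k.+2]addn2 -[k.+1]addn1 !PoszD; ring.
Qed.

Section Gluing.
Variables F1 F2 : seq V.
Hypothesis F1_gt0 : (0 < size F1)%N.
Hypothesis F2_gt0 : (0 < size F2)%N.
Hypothesis widths : same_face_widths F1 F2.

Lemma min_difference_ex chi : exists d, forall a b,
  is_min F1 chi a -> is_min F2 chi b -> d = a - b.
Proof.
have [a ha] := is_min_ex chi F1_gt0; have [b hb] := is_min_ex chi F2_gt0.
by exists (a - b) => a' b' /(is_min_uniq ha) <- /(is_min_uniq hb) <-.
Qed.

Definition min_difference chi : int := sval (cid (min_difference_ex chi)).

Lemma min_differenceE chi a b : is_min F1 chi a -> is_min F2 chi b ->
  min_difference chi = a - b.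
Proof. by rewrite /min_difference; case: cid => d /= h; exact: h. Qed.

Lemma min_differenceZ (k : int) chi : 0 <= k ->
  min_difference (k *: chi) = k * min_difference chi.
Proof.
move=> k0; have [a ha] := is_min_ex chi F1_gt0; have [b hb] := is_min_ex chi F2_gt0.
rewrite (min_differenceE ha hb) (min_differenceE (is_minZ k0 ha) (is_minZ k0 hb)).
by rewrite mulrBr.
Qed.

(** The second difference of each minimum is minus the width of the face of [chi]; the
    two widths cancel. *)
Lemma min_difference_second chi delta :
    adapted F1 chi delta -> adapted F2 chi delta ->
  min_difference (chi + delta) + min_difference (chi - delta) = min_difference chi *+ 2.
Proof.
move=> ad1 ad2.
have adN F : adapted F chi delta -> adapted F chi (- delta).
  move=> ad z w zF wF; have [m h] := ad z w zF wF; exists (- m).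
  by rewrite idotNl oppr_eq0 mulrNN.
have [z [z' [y [y' [[mz mz'] [my my'] e]]]]] := widths chi delta.
rewrite (min_differenceE (lex_min_shift ad1 mz) (lex_min_shift ad2 my)).
rewrite (min_differenceE (lex_min_shift (adN _ ad1) mz') (lex_min_shift (adN _ ad2) my')).
rewrite (min_differenceE (lex_min_min mz) (lex_min_min my)).
have := is_min_uniq (lex_min_min mz) (lex_min_min mz').
have := is_min_uniq (lex_min_min my) (lex_min_min my').
move: e; rewrite !idotBr !idotNl; lia.
Qed.

(** The functionals [chi k] lead from [N phi] to [N psi] in [N] steps.  Each value of
    [delta] on a difference of points divides [N], which makes every [chi k] adapted,
    and [N = 2 * M] is even, so that the midpoint is [M (phi + psi)]. *)
Lemma min_differenceD phi psi :
  min_difference (phi + psi) = min_difference phi + min_difference psi.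
Proof.
pose delta := psi - phi.
have [M [M0 Mdiv]] := common_multiple
  [seq idot delta (w - z) | z <- F1 ++ F2, w <- F1 ++ F2].
pose N := (2 * M)%N; pose chi (k : nat) := (N%:Z *: phi) + k%:Z *: delta.
have ad F k : {subset F <= F1 ++ F2} -> adapted F (chi k) delta.
  move=> FF z w zF wF; have [e|ne] := eqVneq (idot delta (w - z)) 0; first by exists 0.
  have /dvdzP[q qE] : (idot delta (w - z) %| M%:Z)%Z.
    by apply: Mdiv => //; apply: allpairs_f; exact: FF.
  exists (2 * q * idot phi (w - z) + k%:Z) => _.
  by rewrite idotDl !idotZl /N PoszM qE; ring.
have chiS k : chi k.+1 = chi k + delta.
  by rewrite /chi -addrA -[k.+1]addn1 PoszD scalerDl scale1r.
have sub1 : {subset F1 <= F1 ++ F2} by move=> z; rewrite mem_cat => ->.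
have sub2 : {subset F2 <= F1 ++ F2} by move=> z; rewrite mem_cat orbC => ->.
have ap k : min_difference (chi k.+2) + min_difference (chi k) =
    min_difference (chi k.+1) *+ 2.
  rewrite -(min_difference_second (ad F1 k.+1 sub1) (ad F2 k.+1 sub2)).
  by rewrite -chiS (chiS k) addrK.
have {}ap := arithmetic_progression ap.
have e0 : min_difference (chi 0%N) = N%:Z * min_difference phi.
  by rewrite -min_differenceZ // /chi scale0r addr0.
have eN : min_difference (chi N) = N%:Z * min_difference psi.
  by rewrite -min_differenceZ // /chi -scalerDr addrC subrK.
have eM : min_difference (chi M) = M%:Z * min_difference (phi + psi).
  rewrite -min_differenceZ // /chi /N PoszM; congr min_difference.
  by apply/rowP => i; rewrite !mxE; ring.
have := ap N; have := ap M; rewrite eM eN e0 /N PoszM => e1 e2.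
apply: (@mulfI _ M%:Z); first by rewrite eqz_nat -lt0n.
have e3 : M%:Z * min_difference psi =
    M%:Z * min_difference phi + M%:Z * (min_difference (chi 1%N) - N%:Z * min_difference phi).
  by apply: (@mulfI _ 2) => //; rewrite mulrA e2 /N PoszM; ring.
by rewrite e1 [RHS]mulrDr e3 /N PoszM; ring.
Qed.

Lemma min_difference_linear : exists x, forall chi, min_difference chi = idot chi x.
Proof.
pose f := min_difference.
have f0 : f 0 = 0 by apply: (@addrI _ (f 0)); rewrite -min_differenceD !addr0.
have fB : zmod_morphism f by exact/morphD_zmod/min_differenceD.
pose fA : {additive V -> int} := HB.pack f (GRing.isZmodMorphism.Build _ _ f fB).
exists (\row_i f (delta_mx 0 i)) => chi.
rewrite -[LHS]/(fA chi) [in LHS](row_sum_delta chi) raddf_sum.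
apply: eq_bigr => i _; rewrite mxE -[X in X *: _]intz scaler_int raddfMz.
by rewrite -mulrzl intz.
Qed.

End Gluing.

End IntegralFunctionals.

(** * Translates of integral polytopes *)

Section Translates.
Local Open Scope ring_scope.
Local Open Scope classical_set_scope.
Variables (R : realType) (n : nat).
Local Notation V := 'rV[int]_n.
Local Notation point := (@lattice_point R n).

Lemma lattice_pointD z w : point (z + w) = point z + point w.
Proof. exact: map_mxD. Qed.

Lemma lattice_pointB z w : point (z - w) = point z - point w.
Proof. exact: map_mxB. Qed.

Lemma idot_dot (chi z : V) : (idot chi z)%:~R = dot (point chi) (point z).
Proof.
rewrite /idot /dot rmorph_sum; apply: eq_bigr => i _ /=.
by rewrite intrM !mxE.
Qed.

(** Rounding [M a] changes its value at [d] by at most the sum of the absolute values of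
    the coordinates of [d], whereas [M a(d)] grows with [M]. *)
Lemma floor_approx (a : 'rV[R]_n) (d : V) : 0 < dot a (point d) ->
  exists M0 : nat, forall M : nat, (M0 <= M)%N ->
    0 < idot (\row_i Num.floor (M%:R * a 0 i)) d.
Proof.
move=> ad; pose B : R := \sum_i `|(d 0 i)%:~R|.
have B0 : 0 <= B / dot a (point d).
  by apply: divr_ge0; [apply: sumr_ge0|exact: ltW].
exists (Num.bound (B / dot a (point d))) => M MM.
have BM : B < M%:R * dot a (point d).
  rewrite -ltr_pdivrMr //; apply: lt_le_trans (archi_boundP B0) _.
  by rewrite ler_nat.
set A := \row_i _.
suff key : M%:R * dot a (point d) - dot (point A) (point d) <= B.
  by rewrite -(ltr0z R) idot_dot; lra.
rewrite -dotZl /dot -sumrB; apply: ler_sum => i _; rewrite !mxE -mulrBl.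
apply: le_trans (ler_norm _) _; rewrite normrM ler_piMl //.
have := Num.Theory.floor_le (M%:R * a 0 i); have := lt_succ_floor (M%:R * a 0 i).
rewrite intrD => h1 h2; rewrite ger0_norm; lra.
Qed.

Lemma integral_approx (a : 'rV[R]_n) (s : seq V) :
    (forall d, d \in s -> 0 < dot a (point d)) ->
  exists chi : V, forall d, d \in s -> 0 < idot chi d.
Proof.
move=> h; suff [M0 hM] : exists M0 : nat, forall M : nat, (M0 <= M)%N ->
    forall d, d \in s -> 0 < idot (\row_i Num.floor (M%:R * a 0 i)) d.
  by exists (\row_i Num.floor (M0%:R * a 0 i)); exact: hM.
elim: s h => [|d s IH] h; first by exists 0%N.
have [M1 h1] := floor_approx (h d (mem_head _ _)).
have [M2 h2] := IH (fun d' ds => h d' (mem_behead (s := d :: s) ds)).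
exists (maxn M1 M2) => M; rewrite geq_max => /andP[M1M M2M] d'.
by rewrite inE => /orP[/eqP->|]; [exact: h1|exact: h2].
Qed.

Lemma hull_dot (S : set 'rV[R]_n) (a x : 'rV[R]_n) (b : R) :
  (forall y, S y -> dot a y <= b) -> convex_hull S x -> dot a x <= b.
Proof.
move=> h [k [t [p [t0 t1 Sp ->]]]]; rewrite dot_sumr -[b]mul1r -t1 mulr_suml.
by apply: ler_sum => i _; rewrite dotZr ler_wpM2l // h.
Qed.

Definition integral_hull (F : seq V) : set 'rV[R]_n := convex_hull [set` map point F].

Lemma integral_hull1 (x : V) : integral_hull [:: x] = [set point x].
Proof.
rewrite /integral_hull (_ : [set` _] = [set point x]) ?convex_hull1 //.
by apply/seteqP; split=> y; rewrite /= inE => /eqP.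
Qed.

(** The right-hand side is an intersection of half-spaces, so it suffices that each real
    functional attains on it a value not above its minimum on the left; a strict
    violation would persist for an integral functional of nearby direction. *)
Lemma integral_hull_sub (F1 F2 : seq V) (x : V) : (0 < size F2)%N ->
    (forall chi a b, is_min F1 chi a -> is_min F2 chi b -> a = b + idot chi x) ->
    (0 < size F1)%N ->
  integral_hull F1 `<=` minkowski_sum (integral_hull F2) [set point x].
Proof.
move=> F20 h F10.
have dom (a : 'rV[R]_n) z : z \in F1 ->
    exists2 y, y \in F2 & dot a (point (y + x)) <= dot a (point z).
  move=> zF; apply: contrapT => no.
  have [chi pos] : exists chi : V, forall d, d \in [seq y + x - z | y <- F2] -> 0 < idot chi d.
    apply: (@integral_approx a) => _ /mapP[y yF ->].
    rewrite lattice_pointB dotDr dotNr subr_gt0 ltNge; apply/negP => le.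
    by apply: no; exists y.
  have [a1 m1] := is_min_ex chi F10; have [a2 m2] := is_min_ex chi F20.
  have e := h chi _ _ m1 m2; case: m1 m2 => _ /(_ z zF) le [[y yF ya2] _].
  have := pos _ (map_f (fun y => y + x - z) yF).
  by rewrite idotBr idotDr ya2 -e; lia.
have [_ [s sE]] : is_polytope (minkowski_sum (integral_hull F2) [set point x]).
  apply: minkowski_polytope; first exact: convex_hull_polytope.
  by rewrite -integral_hull1; exact: convex_hull_polytope.
rewrite sE => p hp c cs; apply: (hull_dot _ hp) => _ /mapP[z zF ->].
have [y yF] := dom (- c.1) z zF; rewrite !dotNl lerN2 => le.
apply: le_trans le _.
have : polyhedron s (point (y + x)); last by apply.
rewrite -sE lattice_pointD; exists (point y); last by exists (point x).
by apply: convex_hull_sub => /=; exact: map_f.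
Qed.

Lemma integral_hull_translate (F1 F2 : seq V) (x : V) :
    (0 < size F1)%N -> (0 < size F2)%N ->
    (forall chi a b, is_min F1 chi a -> is_min F2 chi b -> a = b + idot chi x) ->
  integral_hull F1 = minkowski_sum (integral_hull F2) [set point x].
Proof.
move=> F10 F20 h; apply/seteqP; split; first exact: integral_hull_sub.
have h' chi a b : is_min F2 chi a -> is_min F1 chi b -> a = b + idot chi (- x).
  by move=> ha hb; rewrite (h _ _ _ hb ha) idotNr addrK.
move=> _ [y yF [_ -> <-]].
have [z zF [_ -> <-]] := integral_hull_sub F10 h' F20 yF.
by rewrite -addrA -lattice_pointD addNr /lattice_point raddf0 addr0.
Qed.

End Translates.

(** * Newton polytopes of determinants *)

Section FaceWidths.
Local Open Scope ring_scope.
Variables (B : unitRingType) (H : groupType) (u : H -> B).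
Hypothesis u_unit : forall h, u h \is a GRing.unit.
Hypothesis B_skew : skew_field B.
Notation TH := (twisted_ring u_unit).
Variables (n : nat) (c : H -> 'rV[int]_n).
Hypothesis c_inj : injective c.
Hypothesis cM : {morph c : h k / (h * k)%g >-> h + k}.
Variables (D : unitRingType) (iota : {rmorphism TH -> D}).
Hypothesis D_ore : ore_localisation iota.
Variables chi delta : 'rV[int]_n.

Let D_skew : skew_field D. Proof. by case: D_ore. Qed.

Definition lower_valuation (x : D) := valuation c iota (flag_cone chi delta) x.
Definition upper_valuation (x : D) := valuation c iota (flag_cone chi (- delta)) x.
(** The two valuations refine [chi] by [delta] and by [- delta], so they locate the two
    ends of the face of the Newton polytope on which [chi] is minimal. *)
Definition face_width (x : D) : int :=
  width (fun x => idot delta (lower_valuation x)) (fun x => idot delta (upper_valuation x)) x.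

Let hlow := flag_cone_positive chi delta.
Let hup := flag_cone_positive chi (- delta).

Let same_height x : x != 0 -> idot chi (upper_valuation x) = idot chi (lower_valuation x).
Proof.
move=> x0; rewrite /lower_valuation.
have [p [q [a [b [pa qb -> ->]]]]] := valuation_fraction B_skew c_inj cM D_ore hlow x0.
have [p0 q0] := (lowest_neq0 pa, lowest_neq0 qb).
have [a' pa'] := lowest_ex c hup p0; have [b' qb'] := lowest_ex c hup q0.
rewrite /upper_valuation (valuationE B_skew c_inj cM D_ore hup pa' qb') !idotBr.
have same (r : TH) e e' : lowest c (flag_cone chi delta) r e ->
    lowest c (flag_cone chi (- delta)) r e' -> idot chi e' = idot chi e.
  move=> [[h hr <-] hmin] [[k kr <-] kmin].
  have := flag_cone_lexle (hmin _ kr); have := flag_cone_lexle (kmin _ hr).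
  by rewrite /lexle; lia.
by rewrite (same _ _ _ pa pa') (same _ _ _ qb qb').
Qed.

Let lower_lex : lex_valuation (fun x => idot chi (lower_valuation x))
  (fun x => idot delta (lower_valuation x)).
Proof.
split=> [x y x0 y0|x y x0 y0|x y x0 y0 xy0].
- by rewrite /lower_valuation (valuation_mul B_skew c_inj cM D_ore hlow) // idotDr.
- by rewrite /lower_valuation (valuation_mul B_skew c_inj cM D_ore hlow) // idotDr.
by case: (valuation_add B_skew c_inj cM D_ore hlow x0 y0 xy0) => /flag_cone_lexle; [left|right].
Qed.

Let upper_lex : lex_valuation (fun x => idot chi (lower_valuation x))
  (fun x => - idot delta (upper_valuation x)).
Proof.
split=> [x y x0 y0|x y x0 y0|x y x0 y0 xy0].
- exact: lex_mulX lower_lex _ _ x0 y0.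
- by rewrite /upper_valuation (valuation_mul B_skew c_inj cM D_ore hup) // idotDr opprD.
rewrite -!same_height // -!idotNl.
by case: (valuation_add B_skew c_inj cM D_ore hup x0 y0 xy0) => /flag_cone_lexle; [left|right].
Qed.

Let bidegree (z : 'rV[int]_n) : int * int := (idot chi z, idot delta z).

Let bidegreeB : {morph bidegree : a b / a - b}.
Proof. by move=> a b; rewrite /bidegree !idotBr. Qed.

Let grM : {morph (bidegree \o c) : h k / (h * k)%g >-> h + k}.
Proof. by move=> h k; rewrite /= /bidegree cM !idotDr. Qed.

Let gr_val w x : x != 0 -> graded iota (bidegree \o c) w x ->
  [/\ idot chi (lower_valuation x) = w.1, idot delta (lower_valuation x) = w.2
    & idot delta (upper_valuation x) = w.2].
Proof.
move=> x0 hx.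
have := graded_valuation B_skew c_inj cM D_ore hlow bidegreeB (fun=> erefl) x0 hx.
have := graded_valuation B_skew c_inj cM D_ore hup bidegreeB (fun=> erefl) x0 hx.
by rewrite /bidegree => <- [].
Qed.

Let iota_span (p : TH) : graded_span (graded iota (bidegree \o c)) (iota p).
Proof.
elim/malgW: p => [|x y hx hy|a h].
- by rewrite rmorph0; exact: graded_span0.
- by rewrite rmorphD; exact: span_add.
apply: (@graded_in_span _ _ (bidegree (c h))); apply: homogeneous_graded => //.
by move=> k /(fsubsetP msuppU_le); rewrite inE => /eqP ->.
Qed.

Lemma face_width_mul x y : x != 0 -> y != 0 ->
  face_width (x * y) = face_width x + face_width y.
Proof.
move=> x0 y0; have := lex_mulE lower_lex x0 y0; have := lex_mulE upper_lex x0 y0.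
rewrite /face_width /width; lia.
Qed.

(** The entries lie in the closure of the graded elements for the bidegree
    [(chi, delta)], so [unimodular_width0] applies. *)
Lemma unimodular_face_width m (A A' : 'M[TH]_m) : A *m A' = 1%:M ->
  dieudonne_rep (map_mx iota A) != 0 /\
  face_width (dieudonne_rep (map_mx iota A)) = 0.
Proof.
move=> AA'.
have entries (C : 'M[TH]_m) : entries_in (span_closure
    (fun x => idot chi (lower_valuation x)) (graded iota (bidegree \o c))) (map_mx iota C).
  by move=> i l; rewrite mxE; exact/span_in_closure/iota_span.
have inv : map_mx iota A *m map_mx iota A' = 1%:M by rewrite -map_mxM AA' map_mx1.
apply: (unimodular_width0 D_skew lower_lex upper_lex _ _ _ _ _ _
  (entries A) (entries A') inv).
- by move=> w; exact: graded0.
- by move=> w x; exact: gradedN.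
- by move=> w x y; exact: (gradedD D_ore grM).
- by move=> w w' x y; exact: (gradedM D_ore grM).
- by move=> w x x0; exact: (gradedV D_ore).
- exact: gr_val.
Qed.

End FaceWidths.

Section Exponents.
Local Open Scope ring_scope.
Variables (B : unitRingType) (H : groupType) (u : H -> B).
Hypothesis u_unit : forall h, u h \is a GRing.unit.
Hypothesis B_skew : skew_field B.
Notation TH := (twisted_ring u_unit).
Variables (n : nat) (c : H -> 'rV[int]_n).
Hypothesis c_inj : injective c.
Hypothesis cM : {morph c : h k / (h * k)%g >-> h + k}.
Variables (D : unitRingType) (iota : {rmorphism TH -> D}).
Hypothesis D_ore : ore_localisation iota.

Definition exponents (p : TH) : seq 'rV[int]_n := [seq c h | h <- msupp p].

Lemma lowest_lex_min chi delta (p : TH) z :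
  lowest c (flag_cone chi delta) p z -> lex_min (exponents p) chi delta z.
Proof.
move=> [[h hp <-] hmin]; split; first exact: map_f.
by move=> _ /mapP[k kp ->]; apply: flag_cone_lexle; exact: hmin.
Qed.

Lemma exponents_gt0 (p : TH) : p != 0 -> (0 < size (exponents p))%N.
Proof.
move=> p0; rewrite size_map lt0n; apply: contra p0 => /nilP supp0.
by rewrite [p]monalgE supp0 big_nil.
Qed.

Lemma face_width_same (p q : TH) : p != 0 -> q != 0 ->
    (forall chi delta, face_width c iota chi delta (iota p / iota q) = 0) ->
  same_face_widths (exponents p) (exponents q).
Proof.
move=> p0 q0 h chi delta.
have lowC := flag_cone_positive chi delta; have upC := flag_cone_positive chi (- delta).
have [z pz] := lowest_ex c lowC p0; have [z' pz'] := lowest_ex c upC p0.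
have [y qy] := lowest_ex c lowC q0; have [y' qy'] := lowest_ex c upC q0.
exists z, z', y, y'; split; [by split; exact: lowest_lex_min..|].
have := h chi delta; rewrite /face_width /width /lower_valuation /upper_valuation.
rewrite (valuationE B_skew c_inj cM D_ore lowC pz qy) (valuationE B_skew c_inj cM D_ore upC pz' qy').
by rewrite !idotBr; lia.
Qed.

Lemma exponents_translate (p q : TH) : p != 0 -> q != 0 ->
    (forall chi delta, face_width c iota chi delta (iota p / iota q) = 0) ->
  exists x, forall chi a b, is_min (exponents p) chi a -> is_min (exponents q) chi b ->
    a = b + idot chi x.
Proof.
move=> p0 q0 /(face_width_same p0 q0) widths.
have [x hx] := min_difference_linear (exponents_gt0 p0) (exponents_gt0 q0) widths.
exists x => chi a b ha hb; rewrite -hx.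
by rewrite (min_differenceE (exponents_gt0 p0) (exponents_gt0 q0) ha hb) addrC subrK.
Qed.

End Exponents.

Section NewtonPolytopes.
Local Open Scope ring_scope.

(** Commutators are killed by any homomorphism to the integers, so the representative of
    the Dieudonne determinant modulo commutators is immaterial. *)
Lemma abel_invariant (D : unitRingType) (f : D -> int) :
    (forall x y, x != 0 -> y != 0 -> f (x * y) = f x + f y) ->
  forall v v' : unit_group D, abel v = abel v' -> f (unit_val v) = f (unit_val v').
Proof.
move=> fM; pose g (v : unit_group D) := f (unit_val v).
have v0 (v : unit_group D) : unit_val v != 0.
  have : unit_val v \is a GRing.unit := valP v.
  by apply: contraTneq => ->; rewrite unitr0.
have gM v v' : g (v * v')%g = g v + g v' by rewrite /g unit_valM fM.
have g1 : g 1%g = 0 by apply: (@addrI _ (g 1%g)); rewrite -gM mulg1 addr0.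
have gV v : g v^-1%g = - g v.
  by apply: (@addrI _ (g v)); rewrite -gM mulgV g1 subrr.
move=> v v' /quotient_projP h.
suff e : g (v^-1 * v')%g = 0 by apply/esym/eqP; rewrite -subr_eq0 addrC -gV -gM e.
elim: h => [//|_ [a [b ->]]|a b _ ha _ hb|a _ ha].
- by rewrite commgEl conjgE !gM !gV; lia.
- by rewrite gM ha hb.
- by rewrite gV ha oppr0.
Qed.

Variables (R : realType) (G : groupType) (K : unitRingType).
Variables (j : {rmorphism group_ring G -> K}) (s : free_part G -> G).
Hypothesis K_skew : skew_field K.
Variables (D : unitRingType) (iota : {rmorphism KH j s -> D}).
Hypothesis D_ore : ore_localisation iota.
Variables (n : nat) (c : free_part G -> 'rV[int]_n).
Hypothesis c_inj : injective c.
Hypothesis cM : {morph c : h k / (h * k)%g >-> h + k}.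

Lemma newton_difference_singleton (p q : KH j s) (p0 : p != 0) (q0 : q != 0) :
    (forall chi delta, face_width c iota chi delta (iota p / iota q) = 0) ->
  is_singleton (polytope_classT (polytope_class (newton_polytope R c p0) -
    polytope_class (newton_polytope R c q0))).
Proof.
move=> /(exponents_translate K_skew c_inj cM D_ore p0 q0)[x hx].
have pt : (0 < size [:: x])%N by [].
have pE : newton_polytope R c p0 = newton_polytope R c q0 + lattice_hull R pt.
  apply: val_inj; rewrite /= -/(@integral_hull R n [:: x]) integral_hull1.
  exact: (integral_hull_translate R (exponents_gt0 c p0) (exponents_gt0 c q0) hx).
exists (lattice_hull R pt).
  by exists (lattice_point R x); rewrite /= -/(@integral_hull R n [:: x]) integral_hull1.
by congr polytope_classT; rewrite pE /polytope_class groth_classD addrC addKr.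
Qed.

End NewtonPolytopes.

Theorem corollary5p16 (R : realType) (G : groupType)
  (G_fg : finitely_generated (abelianization G))
  (K : unitRingType) (j : {rmorphism group_ring G -> K})
  (j_agrarian : agrarian_embedding j)
  (s : free_part G -> G) (s_section : cancel s (@to_free_part G))
  (D : unitRingType) (iota : {rmorphism KH j s -> D})
  (D_ore : ore_localisation iota)
  (n : nat) (c : free_part G -> 'rV[int]_n) (c_coord : lattice_coordinates c)
  (w : Wh G) (T : polytope_groupT R n) :
  Whitehead_newton iota c w T -> is_singleton T.
Proof.
case: j_agrarian => K_skew _; case: c_coord => /bij_inj c_inj cM.
move=> [m [A [[A' [AA' _]] [x [P [_ det_A [p [q [p0 [q0 [v [vx vE ->]]]]]] ->]]]]]].
apply: (newton_difference_singleton R K_skew D_ore c_inj cM) => chi delta.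
pose emb := group_ring_to_KH j s.
have AA'_KH : (map_mx emb A *m map_mx emb A' = 1%:M)%R by rewrite -map_mxM AA' map_mx1.
have [_] := unimodular_face_width K_skew c_inj cM D_ore chi delta AA'_KH.
rewrite -map_mx_comp -vE; move: det_A; rewrite /dieudonne_det.
case: insubP => //= d _ dr [dx] width0.
have := abel_invariant (face_width_mul K_skew c_inj cM D_ore chi delta).
move=> /(_ v d); rewrite vx dx => -> //.
by rewrite dr.
Qed.
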